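(* There is a constant $c$ such that the following holds. Let $\varepsilon<\frac12$ be a constant, let $n$ be sufficiently large (depending on $\varepsilon$), let $m\ge\log n$, and let $t\geq 0$ be an integer. If, for $A$ chosen according to $\mathcal{D}^n_{m,n}$ and partitioned randomly between the two players, Alice and Bob determine the least significant bit of the median of $A$ with error at most $\varepsilon$ using $t$ messages of at most $m$ bits each, then $$m^{2^{t+1}-2}>\frac{n}{(\log n)^{9\cdot 2^t-2}},$$ which implies that $t\ge\log\log_m n-c$.
   Context: $\log$ denotes $\log_2$, $\log^a n=(\log n)^a$, and $[N]=\{1,\dots,N\}$. For a set $A$ of $n$ elements ($n$ even), the median of $A$ is its $n/2$-th largest element. Quantities below are treated as integers (rounding is suppressed). Recursive pairing of $[2n]$. It depends on parameters $m$ and $n_0$. Let $k=m\log^2 n_0$. If $\sqrt n<k\log^3 n_0$ (base case), the elements of $[2n]$ are paired consecutively: $2i-1$ is paired with $2i$ for $i\in[n]$. If $\sqrt n\ge k\log^3 n_0$, let $\gamma=\sqrt n/\log^2 n_0$; the pairing consists of $n-\gamma$ ''shell'' pairs, namely $i$ paired with $2n+1-i$ for $i\in[1,n-\gamma]$, and $\gamma$ ''core'' pairs on the interval $[n-\gamma+1,n+\gamma]$, obtained by placing $k$ recursive pairings (with the same $m,n_0$) of $\gamma/k$ pairs each, shifted, back-to-back on consecutive blocks of $2\gamma/k$ elements of that interval. Distribution $\mathcal{D}^n_{m,n_0}$ on $n$-element sets $A\subseteq[2n]$ (containing exactly one element of each pair). In the base case, one element of each pair $\{2i-1,2i\}$ is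 chosen uniformly and independently to be in $A$. Otherwise: generate $k$ independent instances from $\mathcal{D}^{\gamma/k}_{m,n_0}$ and place shifted versions of them back-to-back in the $k$ blocks of the core; choose $j\in[k]$ uniformly at random; choose a uniformly random subset of $\frac n2-\frac{\gamma}{k}\left(j-\frac12\right)$ elements of $[1,n-\gamma]$ to include in $A$; for every $i\in[1,n-\gamma]\setminus A$ include $2n+1-i$ in $A$. (The median of $A$ is then the median of the $j$-th embedded instance.) In the theorem the distribution is used with $n_0=n$. Random partition: the $n$ pairs of the pairing of $[2n]$ are randomly partitioned equally between Alice and Bob, the partition being known to both and independent of $A$; each player receives the elements of $A$ that lie in his or her pairs. The error is measured over the choice of $A$ and of the partition. The players alternate in sending messages. *)

(* Defs.v *)
(* MathComp world, with the reals of MathComp-Analysis. *)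
From mathcomp Require Import all_boot all_order all_algebra.
From mathcomp Require Import reals exp.

Set Implicit Arguments.
Unset Strict Implicit.
Unset Printing Implicit Defensive.

Import Order.TTheory GRing.Theory Num.Theory.
Local Open Scope ring_scope.

Definition logb (R : realType) (b x : R) : R := ln x / ln b.
Definition log2 (R : realType) (x : R) : R := logb 2 x.

(* Throughout, the element x of [N] = {1, ..., N} is represented by the
   ordinal (or the natural number) x - 1; only [median] shifts back. *)

(* Rounding.  The informal quantities are
     k = m log^2 n0,   gamma = sqrt n / log^2 n0,
   and gamma / k is the number of pairs of each embedded instance.  Here k is
   rounded down, and gamma is rounded down to a multiple of 2k, so that the k
   blocks tile the core, every embedded instance has, like the outer one, an
   even number of pairs, and n/2 - (gamma/k)(j - 1/2) is an integer. *)
Definition nblocks (R : realType) (m n0 : nat) : nat :=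
  Num.truncn (m%:R * log2 (n0%:R : R) ^+ 2).

Definition bsize (R : realType) (m n0 n : nat) : nat :=
  (Num.truncn (Num.sqrt n%:R / log2 (n0%:R : R) ^+ 2
               / (2 * (nblocks R m n0)%:R))).*2.

Definition core (R : realType) (m n0 n : nat) : nat :=
  (nblocks R m n0 * bsize R m n0 n)%N.

Definition base_case (R : realType) (m n0 n : nat) : bool :=
  Num.sqrt n%:R < (nblocks R m n0)%:R * log2 (n0%:R : R) ^+ 3.

Definition block_start (R : realType) (m n0 n b : nat) : nat :=
  (n - core R m n0 n + b * (bsize R m n0 n).*2)%N.

(* The recursions below are on a fuel argument.  Outside the base case and for
   n0 >= 2 the embedded instances satisfy gamma/k <= sqrt n, and gamma/k is
   even, so gamma/k < n; hence n units of fuel are enough. *)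
Fixpoint pairing_rec (R : realType) (m n0 fuel n : nat) : seq (nat * nat) :=
  let consecutive := [seq (i.*2, i.*2.+1) | i <- iota 0 n] in
  if fuel is f.+1 then
    if base_case R m n0 n then consecutive else
      [seq (i, n.*2.-1 - i)%N | i <- iota 0 (n - core R m n0 n)] ++
      flatten [seq [seq (block_start R m n0 n b + q.1,
                         block_start R m n0 n b + q.2)%N
                   | q <- pairing_rec R m n0 f (bsize R m n0 n)]
              | b <- iota 0 (nblocks R m n0)]
  else consecutive.

Definition pairing (R : realType) (m n0 n : nat) : seq (nat * nat) :=
  pairing_rec R m n0 n n.

Definition base_set (n : nat) (e : {ffun 'I_n -> bool}) : {set 'I_(n.*2)} :=
  [set x : 'I_(n.*2) | [exists i : 'I_n, x == (i.*2 + e i)%N :> nat]].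

(* The set built from the lower half S of the shell, with mirrored
   complement, and from the embedded sets T b. *)
Definition rec_set (R : realType) (m n0 n : nat)
    (S : {set 'I_(n - core R m n0 n)})
    (T : {ffun 'I_(nblocks R m n0) -> {set 'I_((bsize R m n0 n).*2)}}) :
    {set 'I_(n.*2)} :=
  [set x : 'I_(n.*2) | [|| [exists i in S, x == i :> nat],
               [exists i in ~: S, x == (n.*2.-1 - i)%N :> nat] |
               [exists b, [exists y in T b,
                  x == (block_start R m n0 n b + y)%N :> nat]]]].

(* n/2 - (gamma/k)(j - 1/2), where j is represented by j - 1. *)
Definition low_card (R : realType) (m n0 n j : nat) : nat :=
  (n./2 - (j * bsize R m n0 n + (bsize R m n0 n)./2))%N.

(* Probability mass function of the distribution on n-element subsets of [2n]:
   each sum ranges over the outcomes of one random choice (the embedded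
   instances T, the index j, the set S), weighted by their probabilities. *)
Fixpoint Drec (R : realType) (m n0 fuel n : nat) :
    {set 'I_(n.*2)} -> R :=
  let base := fun A : {set 'I_(n.*2)} =>
    \sum_(e : {ffun 'I_n -> bool}) 2^-1 ^+ n * (A == base_set e)%:R in
  if fuel is f.+1 then
    if base_case R m n0 n then base else
      fun A : {set 'I_(n.*2)} =>
        \sum_(T : {ffun 'I_(nblocks R m n0) -> {set 'I_((bsize R m n0 n).*2)}})
          (\prod_b Drec R m n0 f (T b)) *
          \sum_(j < nblocks R m n0) (nblocks R m n0)%:R^-1 *
            \sum_(S : {set 'I_(n - core R m n0 n)} |
                  #|S| == low_card R m n0 n j)
              'C(n - core R m n0 n, low_card R m n0 n j)%:R^-1 *
              (A == rec_set S T)%:R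
  else base.

Definition D (R : realType) (m n0 n : nat) (A : {set 'I_(n.*2)}) : R :=
  Drec R m n0 n A.

Definition median (N : nat) (A : {set 'I_N}) : nat :=
  nth 0%N (sort geq [seq (val x).+1 | x <- enum A]) (#|A|./2).-1.

(* A player is a boolean, [true] for Alice and [false] for Bob.  A partition of
   the n pairs is given by the set P of the indices of Alice's pairs. *)
Definition owned (R : realType) (m n0 n : nat) (P : {set 'I_n}) (pl : bool)
    (A : {set 'I_(n.*2)}) : {set 'I_(n.*2)} :=
  [set x : 'I_(n.*2) in A | [exists i : 'I_n, ((i \in P) == pl) &&
     ((x == (nth (0, 0)%N (pairing R m n0 n) i).1 :> nat) ||
      (x == (nth (0, 0)%N (pairing R m n0 n) i).2 :> nat))]].

(* Two-player protocols with alternating messages of at most m bits, in which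
   either player may start.  The next message and the final answer of a player
   depend on the partition, the player's own part of A, and the messages sent
   so far. *)
Record protocol (n m : nat) := Protocol {
  first : bool;
  message : bool -> {set 'I_n} -> {set 'I_(n.*2)} ->
            seq (m.-bseq bool) -> m.-bseq bool;
  answer : bool -> {set 'I_n} -> {set 'I_(n.*2)} ->
           seq (m.-bseq bool) -> bool }.

Definition speaker (n m : nat) (p : protocol n m) (i : nat) : bool :=
  first p (+) odd i.

Fixpoint transcript (n m : nat) (p : protocol n m) (P : {set 'I_n})
    (input : bool -> {set 'I_(n.*2)}) (t : nat) : seq (m.-bseq bool) :=
  if t is u.+1 then
    let h := transcript p P input u in
    let pl := speaker p u in
    rcons h (message p pl P (input pl) h)
  else [::].

(* Both players must know the answer after t messages. *)
Definition correct (R : realType) (n m n0 : nat) (p : protocol n m) (t : nat)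
    (P : {set 'I_n}) (A : {set 'I_(n.*2)}) : bool :=
  let input := fun pl => owned R m n0 P pl A in
  let h := transcript p P input t in
  [forall pl, answer p pl P (input pl) h == odd (median A)].

(* Error over A drawn from the distribution and, independently, a uniformly
   random partition giving n/2 pairs to each player. *)
Definition error (R : realType) (n m n0 : nat) (p : protocol n m) (t : nat) : R :=
  \sum_(A : {set 'I_(n.*2)}) \sum_(P : {set 'I_n} | #|P| == n./2)
    D R m n0 A * 'C(n, n./2)%:R^-1 * (~~ correct R n0 p t P A)%:R.

(* Main.v *)
Require Import Defs.
From mathcomp Require Import all_boot all_order all_algebra.
From mathcomp Require Import reals exp.
From mathcomp Require Import sequences zify ring lra.

(* Round elimination.  Of the two players, the one who does not hold the pair
   of the median errs with probability 1/2 if nothing is said; so only this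
   player is charged for errors, and the charge is inherited by the embedded
   instance that contains the median.

   Let Alice speak first.  Her part of the shell hardly depends on the index j
   of the embedded instance: the number of low elements in it is
   hypergeometric with deviation about sqrt n, while j shifts its mean by at
   most sqrt n / log^2 n0.  Her message has few bits compared with the number k
   of blocks, so it says little about block j.  More precisely, given all of
   Bob's input, the law of the message given Alice's first j blocks is a
   martingale in j whose total expected entropy drop is at most the logarithm
   of the number of messages; hence for an average j the law hardly changes
   when block j of Alice is revealed.  An embedded instance can then be solved
   without the first message: everything but Alice's blocks above j is public,
   Bob samples the message from its law given his own block j and sends it
   together with his reply, and Alice resamples her blocks above j given the
   message.  Since Alice's and Bob's parts of a block are correlated, it has to
   be Bob who samples the message; this costs one more message length in each
   round, which the slack in k absorbs.

   The argument works for every fixed partition that is balanced on the blocks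
   met along the recursion, and Chebyshev's inequality bounds the others. *)

Set Implicit Arguments.
Unset Strict Implicit.
Unset Printing Implicit Defensive.

Import Order.TTheory GRing.Theory Num.Theory.
Local Open Scope ring_scope.

(** * Sums over product spaces *)

Definition upd (I A : finType) (T : {ffun I -> A}) (i : I) (x : A) :
  {ffun I -> A} := [ffun b => if b == i then x else T b].

Lemma upd_upd (I A : finType) (T : {ffun I -> A}) i x y :
  upd (upd T i x) i y = upd T i y.
Proof. by apply/ffunP => b; rewrite !ffunE; case: (b == i). Qed.

Lemma upd_id (I A : finType) (T : {ffun I -> A}) i : upd T i (T i) = T.
Proof. by apply/ffunP => b; rewrite ffunE; case: eqP => [->|]. Qed.

Lemma upd_same (I A : finType) (T : {ffun I -> A}) i x : upd T i x i = x.
Proof. by rewrite ffunE eqxx. Qed.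

Section ProductSums.
Variables (R : comPzRingType) (I A : finType).
Implicit Types (W : I -> A -> R) (T : {ffun I -> A}).

Lemma sum_prod1 W : (forall b, \sum_x W b x = 1) ->
  \sum_(T : {ffun I -> A}) \prod_b W b (T b) = 1.
Proof. by move=> W1; rewrite -bigA_distr_bigA big1. Qed.

(** Swapping [x] with the coordinate [T i] is an involution on the pairs [(x, T)]. After the swap
    [T i] carries the weight [B], and the discarded value is summed out by the hypothesis on
    [W i]. *)
Lemma sum_override W (B : A -> R) i (G : {ffun I -> A} -> R) :
  \sum_x W i x = 1 ->
  \sum_x B x * (\sum_(T : {ffun I -> A}) (\prod_b W b (T b)) * G (upd T i x)) =
  \sum_(T : {ffun I -> A}) (\prod_b (if b == i then B else W b) (T b)) * G T.
Proof.
move=> Wi.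
under eq_bigr do rewrite mulr_sumr.
rewrite pair_big /=.
pose h (p : A * {ffun I -> A}) := (p.2 i, upd p.2 i p.1).
have hK : involutive h.
  by case=> x T; rewrite /h /= upd_same upd_upd upd_id.
rewrite (reindex_inj (inv_inj hK)) /=.
transitivity (\sum_(p : A * {ffun I -> A}) W i p.1 *
  ((\prod_b (if b == i then B else W b) (p.2 b)) * G p.2)).
  apply: eq_bigr => -[x T] _ /=.
  rewrite upd_upd upd_id (bigD1 i) //= [in RHS](bigD1 i) //= upd_same eqxx.
  rewrite (eq_bigr (fun b => (if b == i then B else W b) (T b))).
    by rewrite -!mulrA !(mulrCA (B _)).
  by move=> b /negPf bi; rewrite ffunE bi.
rewrite -(pair_big xpredT xpredT (fun x T => W i x *
  ((\prod_b (if b == i then B else W b) (T b)) * G T))) /=.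
by under eq_bigr do rewrite -mulr_sumr; rewrite -mulr_suml Wi mul1r.
Qed.

Lemma sum_resample W i (G : {ffun I -> A} -> R) :
  \sum_x W i x = 1 ->
  \sum_(T : {ffun I -> A}) (\prod_b W b (T b)) * G T =
  \sum_(T : {ffun I -> A}) (\prod_b W b (T b)) * (\sum_x W i x * G (upd T i x)).
Proof.
move=> Wi; transitivity (\sum_x W i x *
    (\sum_(T : {ffun I -> A}) (\prod_b W b (T b)) * G (upd T i x))).
  rewrite sum_override //; apply: eq_bigr => T _; congr (_ * _).
  by apply: eq_bigr => b _; case: eqP => [->|].
under eq_bigr do rewrite mulr_sumr.
rewrite exchange_big; apply: eq_bigr => T _; rewrite mulr_sumr.
by apply: eq_bigr => x _; rewrite mulrCA.
Qed.

Lemma sum_prod_coord W i (F : A -> R) : (forall b, \sum_x W b x = 1) ->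
  \sum_(T : {ffun I -> A}) (\prod_b W b (T b)) * F (T i) = \sum_x W i x * F x.
Proof.
move=> W1; rewrite (sum_resample _ (W1 i)).
under eq_bigr do under [X in _ * X]eq_bigr do rewrite upd_same.
by rewrite -mulr_suml sum_prod1 // mul1r.
Qed.

End ProductSums.

(** * Conditioning and information gain *)

Lemma sum_pushforward (R : comPzRingType) (A B : finType) (h : A -> B)
    (w : A -> R) (F : B -> R) :
  \sum_x w x * F (h x) = \sum_y (\sum_(x | h x == y) w x) * F y.
Proof.
rewrite (partition_big h xpredT) //=; apply: eq_bigr => y _.
by rewrite mulr_suml; apply: eq_bigr => x /eqP <-.
Qed.

Section Conditioning.
Variables (R : realFieldType) (A B : finType) (a0 : A) (J : A -> B -> R).
Hypothesis J0 : forall a b, 0 <= J a b.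

(** On a [b] of mass zero this is the point mass at [a0], so that [cond b] always sums to one.
    [condE] survives, since all [J a b] then vanish. *)
Definition cond (b : B) (a : A) : R :=
  if \sum_a' J a' b == 0 then (a == a0)%:R else J a b / \sum_a' J a' b.

Lemma cond_ge0 b a : 0 <= cond b a.
Proof.
rewrite /cond; case: ifP => _; first by rewrite ler0n.
by rewrite divr_ge0 // sumr_ge0.
Qed.

Lemma sum_cond b : \sum_a cond b a = 1.
Proof.
rewrite /cond; have [_|nz] := eqVneq (\sum_a' J a' b) 0.
  by rewrite (bigD1 a0) //= eqxx big1 ?addr0 // => a /negPf ->.
by rewrite -mulr_suml divff.
Qed.

Lemma condE b a : (\sum_a' J a' b) * cond b a = J a b.
Proof.
rewrite /cond; case: ifP => [/eqP s0|/negbT nz]; last by rewrite mulrC divfK.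
rewrite s0 mul0r; apply/esym.
exact: (psumr_eq0P (P := xpredT) (F := J^~ b)).
Qed.

End Conditioning.

Section InformationGain.
Variable R : realType.

Definition xlnx (x : R) : R := x * ln x.

(** From [expR (- t) >= 1 - t] comes [expR t * (1 - t) <= 1], while [(1 + t + 2 t^2) (1 - t) = 1 +
    t^2 (1 - 2 t)] is at least one. *)
Lemma expR_le_quad (t : R) : t <= 2^-1 -> expR t <= 1 + t + 2 * t ^+ 2.
Proof.
move=> t2; have e1 := expR_ge1Dx (- t).
have p1 : 0 < expR t := expR_gt0 t.
have e2 : expR t * expR (- t) = 1 by rewrite -expRD subrr expR0.
have : expR t * (1 - t) <= 1 by rewrite -[leRHS]e2 ler_pM2l.
have : 1 <= (1 + t + 2 * t ^+ 2) * (1 - t).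
  have h : 0 <= 1 - 2 * t by lra.
  by have := mulr_ge0 (sqr_ge0 t) h; lra.
move=> h1 h2; have := le_trans h2 h1; rewrite ler_pM2r //; lra.
Qed.

(** The graph of [x ln x] lies above its tangent at [q * expR t], which has slope [ln q + t + 1];
    [expR_le_quad] then replaces the exponential. The extra slope [t], bought at the price
    [2 t^2 q], stands in for strong convexity. *)
Lemma xlnx_ge_tangent (p q t : R) : 0 <= p -> 0 < q -> t <= 2^-1 ->
  (ln q + 1) * (p - q) + t * (p - q) - 2 * t ^+ 2 * q <= xlnx p - xlnx q.
Proof.
move=> p0 q0 t2; have := expR_le_quad t2; rewrite /xlnx.
move: p0; rewrite le_eqVlt => /predU1P[<- _|p0 et].
  (* Completing the square: [1 + t + 2 t^2 = 2 (t + 1/4)^2 + 7/8]. *)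
  have h : 0 <= 1 + t + 2 * t ^+ 2 by have := sqr_ge0 (t + 4^-1); lra.
  by have := mulr_ge0 (ltW q0) h; lra.
have qe0 : 0 < q * expR t by rewrite mulr_gt0 ?expR_gt0.
have : ln (q * expR t / p) <= q * expR t / p - 1.
  have := @le_ln1Dx R (q * expR t / p - 1); rewrite addrCA subrr addr0.
  by apply; rewrite ltrBrDl subrr divr_gt0.
rewrite ln_div ?posrE // lnM ?posrE ?expR_gt0 // expRK => h.
have : p * (ln q + t - ln p) <= p * (q * expR t / p - 1) by rewrite ler_pM2l.
rewrite [X in _ <= X](_ : _ = q * expR t - p); last first.
  by field; rewrite gt_eqF.
move=> h2.
by have : q * expR t <= q * (1 + t + 2 * t ^+ 2); [rewrite ler_pM2l | lra].
Qed.

(** A form of Pinsker's inequality that is linear in the distance: [tau] stays free until the end,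
    so no square roots arise. The tangent bound is used with slope [tau] or [- tau] according to the
    sign of [p x - q], and the first-order terms cancel because [q] is the mean. *)
Lemma information_gain (A : finType) (kap p : A -> R) (tau : R) :
  (forall x, 0 <= kap x) -> \sum_x kap x = 1 -> (forall x, 0 <= p x) ->
  0 <= tau -> tau <= 2^-1 ->
  let q := \sum_x kap x * p x in
  tau * (\sum_x kap x * `|p x - q|) - 2 * tau ^+ 2 * q <=
  \sum_x kap x * xlnx (p x) - xlnx q.
Proof.
move=> k0 k1 p0 t0 t2; set q := \sum_x kap x * p x => /=.
have q0 : 0 <= q by apply: sumr_ge0 => x _; rewrite mulr_ge0.
move: q0; rewrite le_eqVlt => /predU1P[q0|q0].
  have kp x : kap x * p x = 0.
    apply: (psumr_eq0P (P := xpredT) (F := fun x => kap x * p x)) => //.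
    by move=> i _; rewrite mulr_ge0.
  rewrite -q0 /xlnx !mulr0 mul0r !subr0.
  under eq_bigr do rewrite subr0 ger0_norm // kp.
  rewrite big1 // mulr0 sumr_ge0 // => x _.
  by rewrite mulrA kp mul0r.
have qE : \sum_x kap x * p x = q by [].
clearbody q.
have pt x : (ln q + 1) * (kap x * (p x - q)) + tau * (kap x * `|p x - q|)
     - 2 * tau ^+ 2 * q * kap x <= kap x * xlnx (p x) - xlnx q * kap x.
  have H t : t <= 2^-1 -> kap x * ((ln q + 1) * (p x - q) + t * (p x - q)
      - 2 * t ^+ 2 * q) <= kap x * (xlnx (p x) - xlnx q).
    by move=> ht; apply: ler_wpM2l => //; apply: xlnx_ge_tangent.
  case: (ger0P (p x - q)) => _.
    by move: (H _ t2); lra. 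
  by have := H (- tau); rewrite sqrrN => H'; have := H' ltac:(lra); lra.
have : \sum_x ((ln q + 1) * (kap x * (p x - q)) +
    tau * (kap x * `|p x - q|) - 2 * tau ^+ 2 * q * kap x) <=
    \sum_x (kap x * xlnx (p x) - xlnx q * kap x) by apply: ler_sum.
rewrite !big_split /= !sumrN -!mulr_sumr k1 !mulr1.
suff -> : \sum_x kap x * (p x - q) = 0 by rewrite mulr0 add0r.
under eq_bigr do rewrite mulrBr.
by rewrite big_split sumrN /= -mulr_suml k1 mul1r qE subrr.
Qed.

End InformationGain.

(** * Eliminating the first message *)

Definition mix (k : nat) (U : finType) (j : nat) (x x' : {ffun 'I_k -> U}) :
  {ffun 'I_k -> U} := [ffun b : 'I_k => if (b < j)%N then x b else x' b].

Section Resampling.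
Variables (R : realType) (k : nat) (U V : finType).
Variable kap : 'I_k -> V -> U -> R.
Hypothesis kap0 : forall b y x, 0 <= kap b y x.
Hypothesis kap1 : forall b y, \sum_x kap b y x = 1.
Implicit Types (x : {ffun 'I_k -> U}) (y : {ffun 'I_k -> V}).

(* The mean of [G] when the coordinates of index at least [j] are resampled. *)
Definition tail_mean (G : {ffun 'I_k -> U} -> R) (j : nat) x y : R :=
  \sum_(x' : {ffun 'I_k -> U}) (\prod_b kap b (y b) (x' b)) * G (mix j x x').

Lemma sum_kap y : \sum_(x' : {ffun 'I_k -> U}) \prod_b kap b (y b) (x' b) = 1.
Proof. by apply: (@sum_prod1 R _ _ (fun b => kap b (y b))). Qed.

Lemma prod_kap_ge0 y x : 0 <= \prod_b kap b (y b) (x b).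
Proof. exact: prodr_ge0. Qed.

Lemma tail_mean_ge0 G j x y : (forall x', 0 <= G x') -> 0 <= tail_mean G j x y.
Proof.
by move=> G0; apply: sumr_ge0 => x' _; rewrite mulr_ge0 ?prod_kap_ge0.
Qed.

Lemma tail_mean_full G x y : tail_mean G k x y = G x.
Proof.
rewrite /tail_mean (eq_bigr (fun x' : {ffun 'I_k -> U} =>
  (\prod_b kap b (y b) (x' b)) * G x)); last first.
  move=> x' _; congr (_ * G _); apply/ffunP => b.
  by rewrite ffunE ltn_ord.
by rewrite -mulr_suml sum_kap mul1r.
Qed.

Lemma tail_mean_updl G (j : 'I_k) x y a :
  tail_mean G j (upd x j a) y = tail_mean G j x y.
Proof.
apply: eq_bigr => x' _; congr (_ * G _); apply/ffunP => b; rewrite !ffunE.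
by case: eqP => [->|//]; rewrite ltnn.
Qed.

(** [mix j.+1] takes coordinate [j] from [x], so [y j] enters only through the law of a coordinate
    that is discarded. Hence the message law with block [j] revealed can be formed without knowing
    the other player's part of that block. *)
Lemma tail_mean_updr G (j : 'I_k) x y c :
  tail_mean G j.+1 x (upd y j c) = tail_mean G j.+1 x y.
Proof.
have := @sum_override R _ _ (fun b => kap b (y b)) (kap j c) j
  (fun x' => G (mix j.+1 x x')) (kap1 _ _).
rewrite (_ : \sum_(T : {ffun _}) _ = tail_mean G j.+1 x (upd y j c)); last first.
  apply: eq_bigr => x' _; congr (_ * _); apply: eq_bigr => b _.
  by rewrite ffunE; case: eqP => [->|].
move=> <-; transitivity (\sum_a kap j c a * tail_mean G j.+1 x y).
  apply: eq_bigr => a _; congr (_ * _); apply: eq_bigr => x' _.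
  congr (_ * G _); apply/ffunP => b; rewrite !ffunE.
  by case: eqP => [->|//]; rewrite ltnSn.
by rewrite -mulr_suml kap1 mul1r.
Qed.

(** The martingale property: revealing coordinate [j], drawn from its law given [y j], preserves the
    mean. *)
Lemma tail_mean_step G (j : 'I_k) x y :
  \sum_a kap j (y j) a * tail_mean G j.+1 (upd x j a) y = tail_mean G j x y.
Proof.
have := @sum_override R _ _ (fun b => kap b (y b)) (kap j (y j)) j
  (fun x' => G (mix j x x')) (kap1 _ _).
rewrite [RHS](_ : _ = tail_mean G j x y); last first.
  apply: eq_bigr => x' _; congr (_ * _); apply: eq_bigr => b _.
  by case: eqP => [->|].
move=> <-; apply: eq_bigr => a _; congr (_ * _).
apply: eq_bigr => x' _; congr (_ * G _); apply/ffunP => b; rewrite !ffunE.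
by rewrite ltnS leq_eqVlt; case: eqP => [/val_inj ->|bj] /=;
  rewrite ?eqxx ?ltnn //; case: eqP => // /(congr1 val).
Qed.

End Resampling.

(** * Independent blocks, each giving correlated inputs to the two players *)

Section Elimination.
Variables (R : realType) (k : nat) (Om U V Lam M SA : finType).
Variables (mu : Om -> R) (u : 'I_k -> Om -> U) (v : 'I_k -> Om -> V).
Variable om0 : Om.
Hypothesis mu0 : forall w, 0 <= mu w.
Hypothesis mu1 : \sum_w mu w = 1.

Let J (b : 'I_k) (x : U) (y : V) : R :=
  \sum_(w | (u b w == x) && (v b w == y)) mu w.

Let J0 b x y : 0 <= J b x y. Proof. exact: sumr_ge0. Qed.

(* The law of [u b] given the value of [v b]. *)
Definition kap (b : 'I_k) : V -> U -> R := cond (u b om0) (J b).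

Lemma kap_ge0 b y x : 0 <= kap b y x.
Proof. by apply: cond_ge0 => *; apply: J0. Qed.

Lemma sum_kap1 b y : \sum_x kap b y x = 1.
Proof. exact: sum_cond. Qed.

(** Redrawing [u b] from its law given [v b] preserves the joint law: after grouping by the value of
    [v b] this is [condE]. *)
Lemma sum_kap_resample b (F : U -> V -> R) :
  \sum_w mu w * (\sum_x kap b (v b w) x * F x (v b w)) =
  \sum_w mu w * F (u b w) (v b w).
Proof.
rewrite (@sum_pushforward R _ _ (v b) mu
  (fun y => \sum_x kap b y x * F x y)).
rewrite (@sum_pushforward R _ _ (fun w => (u b w, v b w)) mu
  (fun p => F p.1 p.2)).
rewrite -(pair_big xpredT xpredT (fun x y =>
  (\sum_(w | (u b w, v b w) == (x, y)) mu w) * F x y)) /= exchange_big /=.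
apply: eq_bigr => y _; rewrite mulr_sumr; apply: eq_bigr => x _.
rewrite mulrA; congr (_ * _).
have -> : \sum_(w | v b w == y) mu w = \sum_x J b x y.
  rewrite (partition_big (u b) xpredT) //=; apply: eq_bigr => x' _.
  by apply: eq_bigl => w; rewrite andbC.
by rewrite condE.
Qed.

Definition UU (T : {ffun 'I_k -> Om}) : {ffun 'I_k -> U} := [ffun b => u b (T b)].
Definition VV (T : {ffun 'I_k -> Om}) : {ffun 'I_k -> V} := [ffun b => v b (T b)].
Definition EE (F : {ffun 'I_k -> Om} -> R) : R :=
  \sum_(T : {ffun 'I_k -> Om}) (\prod_b mu (T b)) * F T.

Lemma UU_upd T i w : UU (upd T i w) = upd (UU T) i (u i w).
Proof. by apply/ffunP => b; rewrite !ffunE; case: eqP => [->|]. Qed.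

Lemma VV_upd T i w : VV (upd T i w) = upd (VV T) i (v i w).
Proof. by apply/ffunP => b; rewrite !ffunE; case: eqP => [->|]. Qed.

Lemma EE_upd i F : EE F = EE (fun T => \sum_w mu w * F (upd T i w)).
Proof. exact: (@sum_resample R _ _ (fun=> mu)). Qed.

(** [theta] carries data that are not functions of the two inputs, such as the label of another
    block; redrawing coordinate [i] is harmless as long as [theta] ignores that coordinate. *)
Lemma EE_resample (A : Type) i (theta : {ffun 'I_k -> Om} -> A)
    (Psi : {ffun 'I_k -> U} -> {ffun 'I_k -> V} -> A -> R) :
  (forall T w, theta (upd T i w) = theta T) ->
  EE (fun T => \sum_a kap i (VV T i) a * Psi (upd (UU T) i a) (VV T) (theta T)) =
  EE (fun T => Psi (UU T) (VV T) (theta T)).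
Proof.
move=> th; rewrite (EE_upd i) [RHS](EE_upd i); apply: eq_bigr => T _.
congr (_ * _).
pose F a c := Psi (upd (UU T) i a) (upd (VV T) i c) (theta T).
transitivity (\sum_w mu w * (\sum_a kap i (v i w) a * F a (v i w))).
  apply: eq_bigr => w _; rewrite UU_upd VV_upd th; congr (_ * _).
  by apply: eq_bigr => a _; rewrite upd_same upd_upd.
rewrite sum_kap_resample; apply: eq_bigr => w _.
by rewrite UU_upd VV_upd th.
Qed.

Lemma EE_const c : EE (fun=> c) = c.
Proof.
by rewrite /EE -mulr_suml (@sum_prod1 R _ _ (fun=> mu)) ?mul1r.
Qed.

Lemma EE_ge0 F : (forall T, 0 <= F T) -> 0 <= EE F.
Proof. by move=> F0; apply: sumr_ge0 => T _; rewrite mulr_ge0 ?prodr_ge0. Qed.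

Lemma EE_le F G : (forall T, F T <= G T) -> EE F <= EE G.
Proof.
by move=> FG; apply: ler_sum => T _; rewrite ler_wpM2l ?prodr_ge0.
Qed.

Lemma EED F G : EE (fun T => F T + G T) = EE F + EE G.
Proof. by rewrite -big_split; apply: eq_bigr => T _; rewrite mulrDr. Qed.

Lemma EEN F : EE (fun T => - F T) = - EE F.
Proof. by rewrite -sumrN; apply: eq_bigr => T _; rewrite mulrN. Qed.

Lemma EEZ a F : EE (fun T => a * F T) = a * EE F.
Proof. by rewrite mulr_sumr; apply: eq_bigr => T _; rewrite mulrCA. Qed.


Section Message.
Variable f : SA -> {ffun 'I_k -> U} -> M.

(** The law of the message for an observer who knows [s], all of [y] and the first [j] blocks of
    [x]. *)
Definition msg (j : nat) (c : M) (s : SA) (x : {ffun 'I_k -> U})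
    (y : {ffun 'I_k -> V}) : R :=
  tail_mean kap (fun x' => (f s x' == c)%:R) j x y.

Lemma msg_ge0 j c s x y : 0 <= msg j c s x y.
Proof. by apply: tail_mean_ge0 => [*|?]; rewrite ?kap_ge0 ?ler0n. Qed.

Lemma sum_msg j s x y : \sum_c msg j c s x y = 1.
Proof.
rewrite exchange_big -[RHS](sum_kap sum_kap1 y); apply: eq_bigr => x' _ /=.
rewrite -mulr_sumr (bigD1 (f s (mix j x x'))) //= eqxx [X in _ + X]big1 ?addr0 ?mulr1 //.
by move=> c /negPf; rewrite eq_sym => ->.
Qed.

Definition gap (j : nat) (s : SA) : R :=
  EE (fun T => \sum_c `|msg j.+1 c s (UU T) (VV T) - msg j c s (UU T) (VV T)|).

Lemma gap_ge0 j s : 0 <= gap j s.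
Proof. by apply: EE_ge0 => T; apply: sumr_ge0. Qed.

Lemma gap_le2 j s : gap j s <= 2.
Proof.
rewrite -[leRHS]EE_const; apply: EE_le => T.
apply: (@le_trans _ _ (\sum_c (msg j.+1 c s (UU T) (VV T) +
   msg j c s (UU T) (VV T)))).
  apply: ler_sum => c _; apply: le_trans (ler_normB _ _) _.
  by rewrite !ger0_norm ?msg_ge0.
by rewrite big_split /= !sum_msg.
Qed.

(** Minus the conditional entropy, in nats, of the message given [y] and the first [j] blocks of
    [x]. *)
Let Phi (j : nat) (s : SA) : R :=
  EE (fun T => \sum_c xlnx (msg j c s (UU T) (VV T))).

Let Phi_step (tau : R) (j : 'I_k) s : 0 <= tau -> tau <= 2^-1 ->
  tau * gap j s - 2 * tau ^+ 2 <= Phi j.+1 s - Phi j s.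
Proof.
move=> t0 t2.
have -> : gap j s = EE (fun T => \sum_a kap j (VV T j) a *
    \sum_c `|msg j.+1 c s (upd (UU T) j a) (VV T) - msg j c s (UU T) (VV T)|).
  apply: etrans (esym (@EE_resample unit j (fun=> tt) (fun x y _ =>
    \sum_c `|msg j.+1 c s x y - msg j c s x y|) _)) _ => //.
  apply: eq_bigr => T _; congr (_ * _); apply: eq_bigr => a _; congr (_ * _).
  by apply: eq_bigr => c _; rewrite [msg j _ _ (upd _ _ _) _]tail_mean_updl.
have -> : Phi j.+1 s = EE (fun T => \sum_a kap j (VV T j) a *
    \sum_c xlnx (msg j.+1 c s (upd (UU T) j a) (VV T))).
  by rewrite (@EE_resample unit j (fun=> tt) (fun x y _ =>
    \sum_c xlnx (msg j.+1 c s x y))).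
rewrite -EEZ -(EE_const (2 * tau ^+ 2)) -!EEN -!EED; apply: EE_le => T.
(* The price of [information_gain] is proportional to the probability of each message, so over all
   messages it adds up to [2 tau^2] only. *)
have -> : 2 * tau ^+ 2 = 2 * tau ^+ 2 * \sum_c msg j c s (UU T) (VV T).
  by rewrite sum_msg mulr1.
under eq_bigr do rewrite mulr_sumr.
under [X in _ <= X - _]eq_bigr do rewrite mulr_sumr.
rewrite exchange_big /= [X in _ <= X - _]exchange_big /= !mulr_sumr -!sumrB.
apply: ler_sum => c _.
have := @information_gain R U (kap j (VV T j))
  (fun a => msg j.+1 c s (upd (UU T) j a) (VV T)) tau (@kap_ge0 _ _)
  (sum_kap1 _ _) (fun a => msg_ge0 _ _ _ _ _) t0 t2.
rewrite /= [\sum_x kap _ _ _ * msg _ _ _ _ _]tail_mean_step; last exact: sum_kap1.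
by [].
Qed.

(** The entropy drops telescope. At [k] everything is revealed and the message is determined, so
    [Phi] is zero; at [0] the entropy is at most that of the uniform law. *)
Lemma sum_gap (tau : R) s : 0 <= tau -> tau <= 2^-1 ->
  tau * (\sum_(j < k) gap j s) <= ln (#|M|%:R) + 2 * tau ^+ 2 * k%:R.
Proof.
move=> t0 t2.
have : \sum_(j < k) (tau * gap j s - 2 * tau ^+ 2) <=
       \sum_(j < k) (Phi j.+1 s - Phi j s).
  by apply: ler_sum => j _; apply: Phi_step.
rewrite sumrB -mulr_sumr sumr_const card_ord.
rewrite -(big_mkord xpredT (fun j => Phi j.+1 s - Phi j s)) telescope_sumr //.
have -> : Phi k s = 0.
  rewrite /Phi -[RHS]EE_const; apply: eq_bigr => T _; congr (_ * _).
  rewrite big1 // => c _; rewrite /msg tail_mean_full; last exact: sum_kap1.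
  by case: eqP => _; rewrite /xlnx ?mul0r // ln1 mulr0.
have M0 : 0 < #|M|%:R :> R.
  by rewrite ltr0n; apply/card_gt0P; exists (f s (UU [ffun=> om0])).
have : - ln (#|M|%:R) <= Phi 0 s.
  rewrite -[leLHS]EE_const; apply: EE_le => T.
  (* The tangent of [x ln x] at the uniform probability, that is [xlnx_ge_tangent] with [t = 0]. *)
  have : \sum_c ((ln (#|M|%:R^-1) + 1) * (msg 0 c s (UU T) (VV T) - #|M|%:R^-1)
     + xlnx (#|M|%:R^-1)) <= \sum_c xlnx (msg 0 c s (UU T) (VV T)).
    apply: ler_sum => c _; rewrite -lerBrDr.
    have := @xlnx_ge_tangent R (msg 0 c s (UU T) (VV T)) (#|M|%:R^-1) 0.
    by rewrite expr0n /= mulr0 !mul0r addr0 subr0; apply; rewrite ?msg_ge0 ?invr_gt0 ?invr_ge0.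
  have cst (a : R) : \sum_(c : M) a = a * #|M|%:R by rewrite sumr_const mulr_natr.
  rewrite big_split -mulr_sumr sumrB sum_msg /= !cst mulVf ?gt_eqF //.
  by rewrite subrr mulr0 add0r /xlnx mulrAC mulVf ?gt_eqF // mul1r lnV ?posrE.
rewrite -mulr_natr; lra.
Qed.

Section Block.
Variables (SB : finType) (lam : 'I_k -> Om -> Lam).
Variable C : M -> SA -> {ffun 'I_k -> U} -> SB -> {ffun 'I_k -> V} -> Lam -> R.
Hypothesis C0 : forall c s x r y l, 0 <= C c s x r y l.
Hypothesis C1 : forall c s x r y l, C c s x r y l <= 1.

Variables (j : 'I_k) (s : SA) (r : SB) (val : R).
(* An embedded protocol: the second player first computes [sigma], which then
   helps the first player to set up his input of the large instance. *)
Hypothesis valP : forall (sigma : V -> M) (phi : U -> M -> {ffun 'I_k -> U})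
  (chi : V -> {ffun 'I_k -> V}),
  val <= \sum_w mu w * C (sigma (v j w)) s (phi (u j w) (sigma (v j w)))
                         r (chi (v j w)) (lam j w).

(* In the simulation the first player knows all of [y] except its coordinate
   [j], which is therefore blanked out before the resampling law [KA] of her
   coordinates above [j] is formed. *)
Let y0 (y : {ffun 'I_k -> V}) := upd y j (v j om0).

Let JA (x : {ffun 'I_k -> U}) (y : {ffun 'I_k -> V}) (x' : {ffun 'I_k -> U})
    (c : M) : R :=
  (\prod_b kap b (y0 y b) (x' b)) * (f s (mix j.+1 x x') == c)%:R.

Let JA0 x y x' c : 0 <= JA x y x' c.
Proof. by rewrite mulr_ge0 ?prodr_ge0 // => b _; apply: kap_ge0. Qed.

Let sum_JA x y c : \sum_x' JA x y x' c = msg j.+1 c s x y.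
Proof. by rewrite -[RHS](tail_mean_updr sum_kap1 _ _ _ _ (v j om0)). Qed.

Let KA x y : M -> {ffun 'I_k -> U} -> R := cond (UU [ffun=> om0]) (JA x y).

(** The expected cost of the simulation once [c] is announced: the first player redraws her blocks
    above [j] given [c]. *)
Let sim (T : {ffun 'I_k -> Om}) (c : M) : R :=
  \sum_x' KA (UU T) (VV T) c x' *
    C c s (mix j.+1 (UU T) x') r (VV T) (lam j (T j)).

(** [valP] speaks of deterministic embedded protocols, whereas the simulation samples. It is an
    average of deterministic ones: an independent value for every possible argument gives random
    functions [psi] and [phi], and at the actual arguments [sum_prod_coord] recovers the sampling
    laws. *)
Let sim_val : val <= EE (fun T => \sum_c msg j c s (UU T) (VV T) * sim T c).
Proof.
rewrite (EE_upd j) -[leLHS]EE_const; apply: EE_le => T.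
pose W1 b c := msg j c s (UU T) (upd (VV T) j b).
pose W2 (p : U * M) x' := KA (upd (UU T) j p.1) (VV T) p.2 x'.
have W11 b : \sum_c W1 b c = 1 by apply: sum_msg.
have W21 p : \sum_x' W2 p x' = 1 by apply: sum_cond.
pose Z (psi : {ffun V -> M}) (phi : {ffun U * M -> {ffun 'I_k -> U}}) w :=
  C (psi (v j w)) s (mix j.+1 (upd (UU T) j (u j w)) (phi (u j w, psi (v j w))))
    r (upd (VV T) j (v j w)) (lam j w).
have H : val <= \sum_(psi : {ffun V -> M}) (\prod_b W1 b (psi b)) *
   \sum_(phi : {ffun U * M -> {ffun 'I_k -> U}}) (\prod_p W2 p (phi p)) *
     \sum_w mu w * Z psi phi w.
  apply: (@le_trans _ _ (\sum_(psi : {ffun V -> M}) (\prod_b W1 b (psi b)) *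
   \sum_(phi : {ffun U * M -> {ffun 'I_k -> U}}) (\prod_p W2 p (phi p)) * val)).
    under eq_bigr do rewrite -[X in _ * X]mulr_suml sum_prod1 // mul1r.
    by rewrite -mulr_suml sum_prod1 // mul1r.
  apply: ler_sum => psi _; apply: ler_wpM2l.
    by apply: prodr_ge0 => b _; apply: msg_ge0.
  apply: ler_sum => phi _; apply: ler_wpM2l.
    by apply: prodr_ge0 => b _; apply: cond_ge0 => *; apply: JA0.
  by apply: (@valP (fun b => psi b)
    (fun a c => mix j.+1 (upd (UU T) j a) (phi (a, c))) (fun b => upd (VV T) j b)).
apply: (le_trans H).
rewrite le_eqVlt; apply/orP; left; apply/eqP.
transitivity (\sum_w mu w * \sum_(psi : {ffun V -> M}) (\prod_b W1 b (psi b)) *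
   \sum_(phi : {ffun U * M -> {ffun 'I_k -> U}}) (\prod_p W2 p (phi p)) *
      Z psi phi w).
  transitivity (\sum_(psi : {ffun V -> M}) \sum_w mu w * ((\prod_b W1 b (psi b)) *
   \sum_(phi : {ffun U * M -> {ffun 'I_k -> U}}) (\prod_p W2 p (phi p)) *
      Z psi phi w)).
    apply: eq_bigr => psi _; rewrite mulr_sumr.
    under [X in X = _]eq_bigr do rewrite mulr_sumr mulr_sumr.
    rewrite exchange_big /=; apply: eq_bigr => w _.
    rewrite !mulr_sumr; apply: eq_bigr => phi _; ring.
  by rewrite exchange_big /=; apply: eq_bigr => w _; rewrite mulr_sumr.
apply: eq_bigr => w _; congr (_ * _).
pose Y c x' := C c s (mix j.+1 (upd (UU T) j (u j w)) x')
    r (upd (VV T) j (v j w)) (lam j w).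
transitivity (\sum_(psi : {ffun V -> M}) (\prod_b W1 b (psi b)) *
   \sum_x' W2 (u j w, psi (v j w)) x' * Y (psi (v j w)) x').
  apply: eq_bigr => psi _; congr (_ * _).
  by rewrite (@sum_prod_coord R _ _ W2 (u j w, psi (v j w)) (Y (psi (v j w)))).
rewrite (@sum_prod_coord R _ _ W1 (v j w)
  (fun c => \sum_x' W2 (u j w, c) x' * Y c x')) //.
apply: eq_bigr => c _; rewrite UU_upd VV_upd.
rewrite /W1 [in RHS]/msg tail_mean_updl; congr (_ * _).
rewrite /sim UU_upd VV_upd; apply: eq_bigr => x' _.
rewrite /Y upd_same; congr (_ * _).
by rewrite /W2 /KA /= /JA /y0 upd_upd.
Qed.

Let sim_le1 T c : 0 <= sim T c <= 1.
Proof.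
have K0 x' : 0 <= KA (UU T) (VV T) c x' by apply: cond_ge0.
rewrite sumr_ge0 /= => [|x' _]; last by rewrite mulr_ge0.
rewrite -(sum_cond (UU [ffun=> om0]) (JA (UU T) (VV T)) c).
by apply: ler_sum => x' _; rewrite -[leRHS]mulr1 ler_wpM2l.
Qed.

Let G (l : Lam) y x := C (f s x) s x r y l.

(** If the message were drawn with the first player's block [j] taken into account, the simulation
    would be exact: drawing [c] and then the upper blocks given [c] is the same as drawing the
    blocks and computing [c]. *)
Let sim_next T : \sum_c msg j.+1 c s (UU T) (VV T) * sim T c =
  tail_mean kap (G (lam j (T j)) (VV T)) j.+1 (UU T) (VV T).
Proof.
rewrite -[RHS](tail_mean_updr sum_kap1 _ _ _ _ (v j om0)).
transitivity (\sum_c \sum_x' JA (UU T) (VV T) x' c *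
    C c s (mix j.+1 (UU T) x') r (VV T) (lam j (T j))).
  apply: eq_bigr => c _; rewrite mulr_sumr; apply: eq_bigr => x' _.
  by rewrite mulrA -sum_JA condE.
rewrite exchange_big; apply: eq_bigr => x' _ /=.
rewrite (bigD1 (f s (mix j.+1 (UU T) x'))) //= /JA eqxx mulr1 [X in _ + X]big1 ?addr0 //.
by move=> c /negPf; rewrite eq_sym => ->; rewrite mulr0 mul0r.
Qed.

(** The redrawn blocks are exchanged for the true ones one at a time. The label [lam j (T j)] is
    unaffected, because only indices above [j] are redrawn. *)
Let EE_tail d i : (i + d = k)%N -> (j < i)%N ->
  EE (fun T => tail_mean kap (G (lam j (T j)) (VV T)) i (UU T) (VV T)) =
  EE (fun T => G (lam j (T j)) (VV T) (UU T)).
Proof.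
elim: d i => [|d IH] i.
  rewrite addn0 => -> _; apply: eq_bigr => T _.
  by rewrite tail_mean_full //; apply: sum_kap1.
rewrite addnS -addSn => idk ji; have ik : (i < k)%N by rewrite -idk ltnS leq_addr.
rewrite -(IH _ idk (ltnW ji)).
pose i' := Ordinal ik.
rewrite -[RHS](@EE_resample Lam i' (fun T => lam j (T j)) (fun x y l =>
    tail_mean kap (G l y) i.+1 x y)).
  apply: eq_bigr => T _; congr (_ * _).
  by rewrite -[i]/(nat_of_ord i') (tail_mean_step sum_kap1).
move=> T w; rewrite ffunE; case: eqP => // ji'.
by move: ji; rewrite ji' /= ltnn.
Qed.

(** The simulation draws the message from [msg j], an exact one would use [msg j.+1]. As [sim] lies
    in [[0, 1]], the costs differ by at most the [L1] distance of the two laws, whose mean is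
    [gap j s]. *)
Lemma block_elimination : val - gap j s <=
  EE (fun T => C (f s (UU T)) s (UU T) r (VV T) (lam j (T j))).
Proof.
rewrite lerBlDr (le_trans sim_val) //.
rewrite -(EE_tail (subnKC (ltn_ord j)) (ltnSn j)) -EED.
apply: EE_le => T; rewrite -sim_next -big_split; apply: ler_sum => c _ /=.
rewrite -lerBlDl -mulrBl distrC.
apply: (le_trans (ler_norm _)).
have /andP[s0 s1] := sim_le1 T c.
by rewrite normrM (ger0_norm s0) -[leRHS]mulr1 ler_wpM2l.
Qed.

End Block.

(** * Averaging over the index of the block and over the shell *)

Section Shell.
Variables (SB SS : finType) (lam : 'I_k -> Om -> Lam).
Variable C : M -> SA -> {ffun 'I_k -> U} -> SB -> {ffun 'I_k -> V} -> Lam -> R.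
Hypothesis C0 : forall c s x r y l, 0 <= C c s x r y l.
Hypothesis C1 : forall c s x r y l, C c s x r y l <= 1.
Variables (q : 'I_k -> SS -> R) (q0 : SS -> R) (sA : SS -> SA) (sB : SS -> SB).
Variables (eps tau : R) (val : 'I_k -> R).
Hypothesis q_ge0 : forall j S, 0 <= q j S.
Hypothesis sum_q : forall j, \sum_S q j S = 1.
Hypothesis q0_ge0 : forall S, 0 <= q0 S.
Hypothesis sum_q0 : \sum_S q0 S = 1.
Hypothesis leak : forall j (d : SA -> R), (forall s, 0 <= d s <= 2) ->
  \sum_S q j S * d (sA S) <= \sum_S q0 S * d (sA S) + eps.
Hypothesis tau0 : 0 < tau.
Hypothesis tau2 : tau <= 2^-1.
Hypothesis valP : forall j s r (sigma : V -> M)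
    (phi : U -> M -> {ffun 'I_k -> U}) (chi : V -> {ffun 'I_k -> V}),
  val j <= \sum_w mu w * C (sigma (v j w)) s (phi (u j w) (sigma (v j w))) r
                           (chi (v j w)) (lam j w).

Lemma elimination : (0 < k)%N ->
  k%:R^-1 * (\sum_j val j) -
     (ln (#|M|%:R) / (k%:R * tau) + 2 * tau + eps) <=
  k%:R^-1 * (\sum_j \sum_S q j S *
    EE (fun T => C (f (sA S) (UU T)) (sA S) (UU T) (sB S) (VV T) (lam j (T j)))).
Proof.
move=> k0.
have kR : 0 < k%:R :> R by rewrite ltr0n.
have H1 : \sum_j val j - \sum_j \sum_S q j S * gap j (sA S) <=
  \sum_j \sum_S q j S *
    EE (fun T => C (f (sA S) (UU T)) (sA S) (UU T) (sB S) (VV T) (lam j (T j))).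
  rewrite -sumrB; apply: ler_sum => j _.
  rewrite -[val j]mul1r -(sum_q j) mulr_suml -sumrB; apply: ler_sum => S _.
  rewrite -mulrBr ler_wpM2l //; apply: (block_elimination C0 C1) => sigma phi chi.
  exact: valP.
have H2 : \sum_j \sum_S q j S * gap j (sA S) <=
   (ln (#|M|%:R) + 2 * tau ^+ 2 * k%:R) / tau + k%:R * eps.
  (* Under the common law [q0] the shell no longer depends on [j], so for each shell part the gaps
     can be summed over all [j]. *)
  apply: (@le_trans _ _ (\sum_(j < k) (\sum_S q0 S * gap j (sA S) + eps))).
    apply: ler_sum => j _; apply: (@leak j (gap j)) => s.
    by rewrite gap_ge0 gap_le2.
  rewrite big_split /= sumr_const card_ord -[eps *+ k]mulr_natl lerD2r.
  rewrite exchange_big /=.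
  rewrite ler_pdivlMr // mulr_suml.
  rewrite [leRHS](_ : _ = \sum_S q0 S * (ln #|M|%:R + 2 * tau ^+ 2 * k%:R)).
    2: by rewrite -mulr_suml sum_q0 mul1r.
  apply: ler_sum => S _; rewrite -mulr_sumr -[_ * _ * tau]mulrA.
  rewrite ler_wpM2l // mulrC.
  by apply: sum_gap => //; apply: ltW.
apply: (@le_trans _ _ (k%:R^-1 * (\sum_j val j - \sum_j \sum_S q j S * gap j (sA S)))).
  rewrite mulrBr lerB // mulrC ler_pdivrMr //.
  apply: (le_trans H2); rewrite le_eqVlt; apply/orP; left; apply/eqP.
  by field; rewrite !gt_eqF.
by apply: ler_wpM2l => //; rewrite invr_ge0 ltW.
Qed.

End Shell.
End Message.
End Elimination.

(** * Layout of the recursive pairing *)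

Section Layout.
Variables (R : realType) (m n0 : nat).
Notation core := (core R m n0).
Notation bsize := (bsize R m n0).
Notation nblocks := (nblocks R m n0).
Notation base_case := (base_case R m n0).
Notation block_start := (block_start R m n0).
Hypothesis core_le : forall n, (core n <= n)%N.

(** Pair indices follow the order of [pairing_rec]: the shell first, then block after block. *)
Definition shift_owner (n b : nat) (P : nat -> bool) (i : nat) : bool :=
  P (n - core n + b * bsize n + i)%N.

(* The player holding the pair of [x], when [P i] holds the [i]-th pair. *)
Fixpoint owner (f n : nat) (P : nat -> bool) (x : nat) : bool :=
  if f is f'.+1 then
    if base_case n then P x./2 else
    if (x < n - core n)%N then P x else
    if (n + core n <= x)%N then P (n.*2.-1 - x)%N else
    let y := (x - (n - core n))%N in
    owner f' (bsize n) (shift_owner n (y %/ (bsize n).*2) P)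
      (y %% (bsize n).*2)
  else P x./2.

Lemma coreE n : core n = (nblocks * bsize n)%N. Proof. by []. Qed.

Variant position (n x : nat) : Prop :=
| PosLow (i : 'I_(n - core n)) of x = i
| PosHigh (i : 'I_(n - core n)) of x = (n.*2.-1 - i)%N
| PosBlock (b : 'I_nblocks) (y : 'I_((bsize n).*2)) of x = (block_start n b + y)%N.

Lemma positionP n x : (x < n.*2)%N -> position n x.
Proof.
move=> xn; have cn := core_le n; have cE := coreE n.
have [xl|xl] := ltnP x (n - core n); first exact: (@PosLow _ _ (Ordinal xl)).
have [xh|xh] := leqP (n + core n) x.
  have h : (n.*2.-1 - x < n - core n)%N by lia.
  by apply: (@PosHigh _ _ (Ordinal h)) => /=; lia.
pose y := (x - (n - core n))%N; have yc : (y < nblocks * (bsize n).*2)%N.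
  by rewrite -doubleMr -cE /y; lia.
have bs0 : (0 < (bsize n).*2)%N by case: (bsize n).*2 yc => //; rewrite muln0.
have hb : (y %/ (bsize n).*2 < nblocks)%N by rewrite ltn_divLR.
have hy : (y %% (bsize n).*2 < (bsize n).*2)%N by rewrite ltn_mod.
apply: (@PosBlock _ _ (Ordinal hb) (Ordinal hy)).
rewrite /block_start /= -addnA -divn_eq /y; lia.
Qed.

Lemma block_bounds n (b : 'I_nblocks) (y : 'I_((bsize n).*2)) :
  (n - core n <= block_start n b + y)%N /\ (block_start n b + y < n + core n)%N.
Proof.
have cn := core_le n; have cE := coreE n; rewrite /block_start.
split; first by lia.
have : (b * (bsize n).*2 + y < nblocks * (bsize n).*2)%N.
  apply: (@leq_trans (b.+1 * (bsize n).*2)); last by rewrite leq_mul2r ltn_ord orbT.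
  by rewrite mulSn addnC ltn_add2r.
rewrite -[X in (_ < X)%N -> _]doubleMr -cE; lia.
Qed.

Lemma block_inj n (b b' : 'I_nblocks) (y y' : 'I_((bsize n).*2)) :
  (block_start n b + y = block_start n b' + y')%N -> b = b' /\ y = y'.
Proof.
rewrite /block_start -!addnA => /addnI h.
have bs0 : (0 < (bsize n).*2)%N by apply: leq_ltn_trans (ltn_ord y).
have := congr1 (divn^~ (bsize n).*2) h; have := congr1 (modn^~ (bsize n).*2) h.
rewrite /= !modnMDl !divnMDl // !modn_small ?ltn_ord // !divn_small ?ltn_ord //.
by rewrite !addn0 => yy bb; split; apply: val_inj.
Qed.

Section Members.
Variable n : nat.
Variables (S : {set 'I_(n - core n)})
  (T : {ffun 'I_nblocks -> {set 'I_((bsize n).*2)}}).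

Lemma rec_set_low (i : 'I_(n - core n)) (x : 'I_(n.*2)) : x = i :> nat ->
  (x \in rec_set S T) = (i \in S).
Proof.
move=> xi; have cn := core_le n; have hi := ltn_ord i; rewrite inE.
apply/or3P/idP => [[/exists_inP[i' iS /eqP e]|/exists_inP[i' iS /eqP e]|]|iS].
- by rewrite (_ : i = i') //; apply: val_inj; rewrite /= -xi.
- by have := ltn_ord i'; lia.
- move=> /existsP[b /exists_inP[y _ /eqP e]].
  by have [] := block_bounds b y; lia.
by apply: Or31; apply/exists_inP; exists i => //; apply/eqP.
Qed.

Lemma rec_set_high (i : 'I_(n - core n)) (x : 'I_(n.*2)) :
  x = (n.*2.-1 - i)%N :> nat -> (x \in rec_set S T) = (i \notin S).
Proof.
move=> xi; have cn := core_le n; have hi := ltn_ord i; rewrite inE.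
apply/or3P/idP => [[/exists_inP[i' iS /eqP e]|/exists_inP[i' iS /eqP e]|]|iS].
- by have := ltn_ord i'; lia.
- rewrite (_ : i = i'); first by rewrite inE in iS.
  by apply: val_inj => /=; have := ltn_ord i'; lia.
- move=> /existsP[b /exists_inP[y _ /eqP e]].
  by have [] := block_bounds b y; lia.
by apply: Or32; apply/exists_inP; exists i; rewrite ?inE //; apply/eqP.
Qed.

Lemma rec_set_block (b : 'I_nblocks) (y : 'I_((bsize n).*2)) (x : 'I_(n.*2)) :
  x = (block_start n b + y)%N :> nat -> (x \in rec_set S T) = (y \in T b).
Proof.
move=> xi; have cn := core_le n; rewrite inE.
have [h1 h2] := block_bounds b y.
apply/or3P/idP => [[/exists_inP[i' iS /eqP e]|/exists_inP[i' iS /eqP e]|]|iS].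
- by have := ltn_ord i'; lia.
- by have := ltn_ord i'; lia.
- move=> /existsP[b' /exists_inP[y' yT /eqP e]].
  have [-> ->] // : b = b' /\ y = y' by apply: block_inj; rewrite -xi.
by apply: Or33; apply/existsP; exists b; apply/exists_inP; exists y => //; apply/eqP.
Qed.

End Members.

Section Node.
Variables (n f : nat).
Hypothesis nb : base_case n = false.
Variable P : nat -> bool.

Lemma owner_low (i : 'I_(n - core n)) : owner f.+1 n P i = P i.
Proof. by rewrite /= nb ltn_ord. Qed.

Lemma owner_high (i : 'I_(n - core n)) : owner f.+1 n P (n.*2.-1 - i)%N = P i.
Proof.
have cn := core_le n; have := ltn_ord i => hi; rewrite /= nb.
rewrite ifF; last by apply/negbTE; rewrite -leqNgt; lia.
rewrite ifT; last by lia.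
by congr P; lia.
Qed.

Lemma owner_block (b : 'I_nblocks) (y : 'I_((bsize n).*2)) :
  owner f.+1 n P (block_start n b + y)%N =
  owner f (bsize n) (shift_owner n b P) y.
Proof.
have [h1 h2] := block_bounds b y; rewrite /= nb ltnNge h1 leqNgt h2 /=.
have -> : (block_start n b + y - (n - core n) = b * (bsize n).*2 + y)%N.
  by rewrite /block_start; lia.
have bs0 : (0 < (bsize n).*2)%N by apply: leq_ltn_trans (ltn_ord y).
by rewrite modnMDl divnMDl // modn_small // divn_small // addn0.
Qed.

End Node.


Definition share (N : nat) (P : nat -> bool) (pl : bool) : {set 'I_N} :=
  [set i : 'I_N | P i == pl].

Definition own (f n : nat) (P : nat -> bool) (pl : bool) (A : {set 'I_(n.*2)}) :
  {set 'I_(n.*2)} := [set x in A | owner f n P x == pl].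

Lemma in_own f n P pl (A : {set 'I_(n.*2)}) x :
  (x \in own f P pl A) = (x \in A) && (owner f n P x == pl).
Proof. by rewrite inE. Qed.

(** A player's input depends only on that player's part of the shell and of the blocks. Restricting
    [S] moves the other player's shell pairs to the upper half, but [own] erases those anyway. *)
Lemma own_rec_set f n P pl (S : {set 'I_(n - core n)})
    (T : {ffun 'I_nblocks -> {set 'I_((bsize n).*2)}}) :
  base_case n = false ->
  own f.+1 P pl (rec_set S T) =
  own f.+1 P pl (rec_set (S :&: share (n - core n) P pl)
    [ffun b : 'I_nblocks => own f (shift_owner n b P) pl (T b)]).
Proof.
move=> nb; apply/setP => x.
have [i xi|i xi|b y xi] := positionP (ltn_ord x); rewrite !in_own.
- rewrite !(rec_set_low _ _ xi) xi (owner_low _ nb) !inE.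
  by case: (i \in S); case: (P i == pl).
- rewrite !(rec_set_high _ _ xi) xi (owner_high _ nb) !inE.
  by case: (i \in S); case: (P i == pl).
- rewrite !(rec_set_block _ _ xi) xi (owner_block _ nb) ffunE in_own.
  by case: (y \in T b); case: (owner _ _ _ _ == pl).
Qed.

Lemma ownerC f n P x : owner f n (fun i => ~~ P i) x = ~~ owner f n P x.
Proof.
elim: f n P x => [|f IH] n P x //=.
do 3 case: ifP => // _; exact: (IH _ (shift_owner n _ P)).
Qed.

Lemma ownC f n P pl (A : {set 'I_(n.*2)}) :
  own f (fun i => ~~ P i) pl A = own f P (~~ pl) A.
Proof.
by apply/setP => x; rewrite !inE ownerC; case: (owner _ _ _ _); case: pl.
Qed.

Lemma size_pairing f n : size (pairing_rec R m n0 f n) = n.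
Proof.
elim: f n => [|f IH] n /=; first by rewrite size_map size_iota.
case: ifP => _; first by rewrite size_map size_iota.
rewrite size_cat size_map size_iota size_flatten /shape -map_comp.
rewrite (eq_map (g := fun=> bsize n)); last by move=> b /=; rewrite size_map IH.
rewrite (_ : sumn _ = core n); first by rewrite subnK.
rewrite coreE -{2}(size_iota 0 nblocks).
by elim: (iota _ _) => //= b s ->; rewrite mulSn.
Qed.

Lemma nth_flatten_uniform (A : Type) (x0 : A) (G : nat -> seq A) s a k b i :
  (forall c, size (G c) = s) -> (b < k)%N -> (i < s)%N ->
  nth x0 (flatten [seq G c | c <- iota a k]) (b * s + i) = nth x0 (G (a + b)%N) i.
Proof.
move=> Gs; elim: k a b => [|k IH] a [|b] //= bk is_.
  by rewrite nth_cat Gs is_ addn0.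
by rewrite nth_cat Gs mulSn -addnA ltnNge leq_addr /= addKn IH // addSnnS.
Qed.

Lemma nth_pairing_leaf n (i : nat) : (i < n)%N ->
  nth (0, 0)%N [seq (i.*2, i.*2.+1) | i <- iota 0 n] i = (i.*2, i.*2.+1).
Proof. by move=> hi; rewrite (nth_map 0%N) ?size_iota // nth_iota. Qed.

Definition in_pair (p : nat * nat) (x : nat) : bool := (x == p.1) || (x == p.2).

(** Links the list of pairs, by which [owned] is defined, to the recursion [owner], which follows
    the tree of embedded instances. *)
Lemma pairing_owner f n (P : nat -> bool) (pl : bool) x :
  [exists i : 'I_n, (P i == pl) &&
     in_pair (nth (0, 0)%N (pairing_rec R m n0 f n) i) x] =
  (x < n.*2)%N && (owner f n P x == pl).
Proof.
have leaf n' (P' : nat -> bool) x' : [exists i : 'I_n', (P' i == pl) &&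
     in_pair (nth (0, 0)%N [seq (i.*2, i.*2.+1) | i <- iota 0 n'] i) x'] =
  (x' < n'.*2)%N && (P' x'./2 == pl).
  apply/existsP/andP => [[i]|[xn /eqP <-]].
    rewrite nth_pairing_leaf // /in_pair /= => /andP[/eqP <-] /orP[] /eqP ->.
      by rewrite doubleK ltn_double ltn_ord.
    by rewrite -[(i.*2.+1)./2]/(uphalf _) uphalf_double; split => //; have := ltn_ord i; lia.
  have hx : (x'./2 < n')%N by lia.
  by exists (Ordinal hx); rewrite eqxx nth_pairing_leaf //= /in_pair /=; lia.
elim: f n P x => [|f IH] n P x; rewrite [pairing_rec _ _ _ _ _]/=.
  exact: leaf.
case: ifP => nb; first by rewrite leaf /= nb.
have cn := core_le n; have cE := coreE n.
set L := [seq _ | i <- iota 0 (n - core n)].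
have sL : size L = (n - core n)%N by rewrite size_map size_iota.
have nL (i : 'I_(n - core n)) : nth (0, 0)%N L i = (val i, (n.*2.-1 - i)%N).
  by rewrite (nth_map 0%N) ?size_iota // nth_iota.
set B := flatten _.
have nB (b : 'I_nblocks) (i : 'I_(bsize n)) :
    nth (0, 0)%N B (b * bsize n + i) =
    let q := nth (0, 0)%N (pairing_rec R m n0 f (bsize n)) i in
    (block_start n b + q.1, block_start n b + q.2)%N.
  rewrite (@nth_flatten_uniform _ _ _ (bsize n)) //.
    by rewrite (nth_map (0, 0)%N) // size_pairing.
  by move=> c; rewrite size_map size_pairing.
have bnd (b : 'I_nblocks) (i : 'I_(bsize n)) : (n - core n + b * bsize n + i < n)%N.
  have : (b * bsize n + i < nblocks * bsize n)%N; last by lia.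
  apply: (@leq_trans (b.+1 * bsize n)); last by rewrite leq_mul2r ltn_ord orbT.
  by rewrite mulSn addnC ltn_add2r.
have block (b : 'I_nblocks) (i : 'I_(bsize n)) y : P (n - core n + b * bsize n + i)%N == pl ->
    in_pair (nth (0, 0)%N (pairing_rec R m n0 f (bsize n)) i) y ->
    (y < (bsize n).*2)%N && (owner f (bsize n) (shift_owner n b P) y == pl).
  by move=> Pi yi; rewrite -IH; apply/existsP; exists i; rewrite /shift_owner Pi.
apply/existsP/andP => [[i /andP[Pi]]|[xn]].
  rewrite nth_cat sL; case: ltnP => iN.
    rewrite -[i : nat]/(nat_of_ord (Ordinal iN)) nL => ix.
    have /orP[/eqP xE|/eqP xE] : (x == i) || (x == n.*2.-1 - i)%N := ix.
      split; first by have := ltn_ord i; lia.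
      by rewrite xE -[i : nat]/(nat_of_ord (Ordinal iN)) (owner_low _ nb).
    split; first by have := ltn_ord i; lia.
    by rewrite xE -[i : nat]/(nat_of_ord (Ordinal iN)) (owner_high _ nb).
  pose j := (i - (n - core n))%N; have jc : (j < nblocks * bsize n)%N.
    by have := ltn_ord i; rewrite -cE /j; lia.
  have bs0 : (0 < bsize n)%N by case: (bsize n) jc => //; rewrite muln0.
  have hb : (j %/ bsize n < nblocks)%N by rewrite ltn_divLR.
  have hy : (j %% bsize n < bsize n)%N by rewrite ltn_mod.
  have jE : j = (Ordinal hb * bsize n + Ordinal hy)%N by rewrite /= -divn_eq.
  rewrite -/j jE nB; set q := nth _ _ _ => qx.
  have Pj : P (n - core n + Ordinal hb * bsize n + Ordinal hy)%N == pl.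
    by rewrite -addnA -jE -(eqP Pi); apply/eqP; congr P; rewrite /j; lia.
  have [y xE yq] : exists2 y, x = (block_start n (Ordinal hb) + y)%N & in_pair q y.
    by case/orP: qx => /eqP ->; eexists; rewrite // /in_pair eqxx ?orbT.
  have /andP[y2 yo] := block _ _ _ Pj yq.
  have := @owner_block n f nb P (Ordinal hb) (Ordinal y2).
  have [_] := block_bounds (Ordinal hb) (Ordinal y2).
  rewrite -[(block_start _ _ + _)%N]xE => xl ->.
  by split => //; have := coreE n; lia.
have [i xi|i xi|b y xi] := positionP xn.
- rewrite xi (owner_low _ nb) => Pi.
  have hi : (i < n)%N by have := ltn_ord i; lia.
  by exists (Ordinal hi); rewrite Pi nth_cat sL /= ltn_ord nL /in_pair /= eqxx.
- rewrite xi (owner_high _ nb) => Pi.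
  have hi : (i < n)%N by have := ltn_ord i; lia.
  by exists (Ordinal hi); rewrite Pi nth_cat sL /= ltn_ord nL /in_pair /= eqxx orbT.
rewrite xi (owner_block _ nb) => oy.
have := IH (bsize n) (shift_owner n b P) y; rewrite ltn_ord oy.
case/existsP => i /andP[Pi iy]; exists (Ordinal (bnd b i)).
apply/andP; split; first exact: Pi.
rewrite nth_cat sL ifF /=; last by apply/negbTE; rewrite -leqNgt -addnA leq_addr.
rewrite -addnA addKn nB.
by case/orP: iy => /eqP ->; rewrite /in_pair eqxx ?orbT.
Qed.

End Layout.
Arguments owner : simpl never.

(** * The median of the recursive set *)

Section Median.
Local Open Scope nat_scope.

Lemma count_above_nth s i : sorted gtn s -> i < size s ->
  count (fun w => nth 0 s i < w) s = i.
Proof.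
elim: s i => [|a s IH] [|i] //= ps.
  rewrite ltnn add0n => _; apply/eqP; rewrite -leqn0 leqNgt -has_count -all_predC.
  move: ps; rewrite (path_sortedE (rev_trans ltn_trans)) => /andP[/allP h _].
  by apply/allP => w /h /=; rewrite -leqNgt => /ltnW.
rewrite ltnS => is_; rewrite IH ?(path_sorted ps) //.
move: ps; rewrite (path_sortedE (rev_trans ltn_trans)) => /andP[/allP h _].
by rewrite (h _ (mem_nth 0 is_)).
Qed.

Definition above (N : nat) (A : {set 'I_N}) (x : nat) : nat :=
  #|[set y in A | x < y]|.

Lemma aboveE N (A : {set 'I_N}) x : above A x = \sum_(w in A) (x < w).
Proof.
rewrite /above -sum1_card big_mkcond [RHS]big_mkcond; apply: eq_bigr => w _.
by rewrite inE; case: (w \in _) => //=; case: ltnP.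
Qed.

Lemma medianP N (A : {set 'I_N}) : 0 < #|A| ->
  exists x : 'I_N, [/\ x \in A, above A x = #|A|./2.-1 & median A = x.+1].
Proof.
move=> A0; rewrite /median; set i := _.-1; set s := sort _ _.
have ss : size s = #|A| by rewrite size_sort size_map -cardE.
have is_ : i < size s by rewrite ss /i; lia.
have : nth 0 s i \in s by apply: mem_nth.
rewrite mem_sort => /mapP[x]; rewrite mem_enum => xA xE.
exists x; split => //; rewrite /above.
have so : sorted gtn s.
  rewrite gtn_sorted_uniq_geq sort_uniq map_inj_uniq ?enum_uniq /=; last first.
    by move=> a b [] /val_inj.
  by apply: sort_sorted => a b; apply: leq_total.
rewrite -/i -[RHS](count_above_nth so is_) xE.
have -> : count (fun w => x.+1 < w) s = count (fun w => x.+1 < w) [seq (val x).+1 | x <- enum A].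
  by apply/permP; rewrite perm_sort.
rewrite count_map -sum1_count big_enum_cond /= -sum1_card.
by apply: eq_bigl => y; rewrite inE.
Qed.

Lemma median_unique N (A : {set 'I_N}) (x : 'I_N) : x \in A ->
  above A x = #|A|./2.-1 -> median A = x.+1.
Proof.
move=> xA ax; have A0 : 0 < #|A| by apply/card_gt0P; exists x.
have [y [yA ay ->]] := medianP A0; congr _.+1.
have mono (a b : 'I_N) : b \in A -> a < b -> above A b < above A a.
  move=> bA ab; apply/proper_card/properP; split.
    by apply/subsetP => w; rewrite !inE => /andP[-> /(ltn_trans ab)].
  by exists b; rewrite !inE bA /= ?ltnn ?ab.
case: (ltngtP x y) => // h.
  by have := mono _ _ yA h; rewrite ax ay ltnn.
by have := mono _ _ xA h; rewrite ax ay ltnn.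
Qed.

End Median.

Section RecSet.
Local Open Scope nat_scope.
Variables (R : realType) (m n0 : nat).
Notation core := (core R m n0).
Notation bsize := (bsize R m n0).
Notation nblocks := (nblocks R m n0).
Notation base_case := (base_case R m n0).
Notation block_start := (block_start R m n0).
Notation low_card := (low_card R m n0).
Hypothesis core_le : forall n, core n <= n.

Lemma sum_layout n (F : nat -> nat) :
  \sum_(x < n.*2) F x =
  \sum_(i < n - core n) F i + \sum_(b < nblocks) \sum_(y < (bsize n).*2)
    F (block_start n b + y) + \sum_(i < n - core n) F (n.*2.-1 - i).
Proof.
have cn := core_le n; have cE : core n = nblocks * bsize n by [].
rewrite -(big_mkord xpredT F) (big_cat_nat (n := n - core n)) //=; last by lia.
rewrite (big_cat_nat (n := n + core n) (m := n - core n)) //=; [|lia|lia].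
rewrite addnA; congr (_ + _ + _).
- by rewrite big_mkord.
- have -> : n + core n = n - core n + nblocks * (bsize n).*2.
    by rewrite -doubleMr -cE; lia.
  rewrite /block_start; elim: nblocks => [|k IH].
    by rewrite mul0n addn0 big_geq // big_ord0.
  rewrite big_ord_recr -IH /= (big_cat_nat (n := n - core n + k * (bsize n).*2)) /=.
  - congr (_ + _); rewrite mulSnr addnA -{1}[n - core n + k * _]add0n big_addn addKn.
    rewrite big_mkord.
    by apply: eq_bigr => i _; rewrite addnC.
  - by rewrite leq_addr.
  by rewrite leq_add2l leq_mul2r leqnSn orbT.
rewrite -(big_mkord xpredT (fun i => F (n.*2.-1 - i))) [RHS]big_nat_rev /= add0n.
rewrite -{1}[n + core n]add0n big_addn.
have -> : n.*2 - (n + core n) = n - core n by lia.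
apply: eq_big_nat => i /andP[_ hi]; congr F; lia.
Qed.

Section Node.
Variables (n : nat) (S : {set 'I_(n - core n)})
  (T : {ffun 'I_nblocks -> {set 'I_((bsize n).*2)}}).

Lemma sum_rec_set (G : nat -> nat) :
  \sum_(x in rec_set S T) G x =
  \sum_(i in S) G i + \sum_b \sum_(y in T b) G (block_start n b + y) +
  \sum_(i in ~: S) G (n.*2.-1 - i).
Proof.
have cn := core_le n.
pose F x := if insub x is Some x' then (x' \in rec_set S T) * G x else 0.
have FE (x : 'I_(n.*2)) : F x = (x \in rec_set S T) * G x by rewrite /F valK.
transitivity (\sum_(x < n.*2) F x).
  by rewrite big_mkcond; apply: eq_bigr => x _; rewrite FE; case: ifP; rewrite ?mul1n.
have in2 x : x < n.*2 -> exists x' : 'I_(n.*2), x = x' by move=> h; exists (Ordinal h).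
rewrite sum_layout; congr (_ + _ + _).
- rewrite [RHS]big_mkcond; apply: eq_bigr => i _.
  have [|x xE] := in2 i; first by have := ltn_ord i; lia.
  by rewrite xE FE (rec_set_low core_le _ _ (esym xE)); case: ifP; rewrite ?mul1n.
- apply: eq_bigr => b _; rewrite [RHS]big_mkcond; apply: eq_bigr => y _.
  have [|x xE] := in2 (block_start n b + y).
    by have [] := block_bounds core_le b y; lia.
  by rewrite xE FE (rec_set_block core_le _ _ (esym xE)); case: ifP; rewrite ?mul1n.
rewrite [RHS]big_mkcond; apply: eq_bigr => i _.
have [|x xE] := in2 (n.*2.-1 - i); first by have := ltn_ord i; lia.
rewrite xE FE (rec_set_high core_le _ _ (esym xE)) inE.
by case: ifP; rewrite ?mul1n.
Qed.

Hypothesis cT : forall b, #|T b| = bsize n.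

Lemma card_rec_set : #|rec_set S T| = n.
Proof.
have cn := core_le n; rewrite -sum1_card (sum_rec_set (fun=> 1)) !sum1_card.
under eq_bigr do rewrite sum1_card cT.
rewrite sum_nat_const card_ord -[nblocks * _]/(core n).
have := cardsC S; rewrite card_ord; lia.
Qed.

Lemma sum_ltn_ord k j : \sum_(b < k) (j < b) = k - j.+1.
Proof.
elim: k => [|k IH]; first by rewrite big_ord0.
by rewrite big_ord_recr /= IH; case: ltnP => h; lia.
Qed.

(** Above the median of block [j] lie the upper shell elements, [n - core n - #|S|] in number, the
    [bsize n] elements of each later block, and [bsize n / 2 - 1] elements of block [j]. The choice
    of [low_card] makes the total [n / 2 - 1]. *)
Lemma median_rec_set (j : 'I_nblocks) : ~~ odd n -> (core n).*2 <= n ->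
  0 < bsize n -> #|S| = low_card n j ->
  median (rec_set S T) = block_start n j + median (T j).
Proof.
move=> on c2 bs0 cS; have cn := core_le n.
have [x [xT ax ->]] : exists x : 'I_((bsize n).*2),
    [/\ x \in T j, above (T j) x = #|T j|./2.-1 & median (T j) = x.+1].
  by apply: medianP; rewrite cT.
rewrite addnS.
have [bl bh] := block_bounds core_le j x.
have zn : block_start n j + x < n.*2 by lia.
apply: (@median_unique _ _ (Ordinal zn)).
  by rewrite (rec_set_block core_le (x := Ordinal zn) S T (b := j) (y := x)).
rewrite card_rec_set aboveE /=; set z := block_start n j + x.
rewrite (sum_rec_set (fun w => z < w)) [X in X + _ + _]big1; last first.
  by move=> i _; case: ltnP => //; have := ltn_ord i; rewrite -/z in bl; lia.
have -> : \sum_(i in ~: S) (z < n.*2.-1 - i) = n - core n - #|S|.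
  rewrite (eq_bigr (fun=> 1)); first by rewrite sum1_card; have := cardsC S; rewrite card_ord; lia.
  by move=> i _; have := ltn_ord i; rewrite -/z in bh; case: ltnP => //; lia.
have -> : \sum_b \sum_(y in T b) (z < block_start n b + y) =
    \sum_(b < nblocks) ((j < b) * bsize n + (b == j) * (bsize n)./2.-1).
  apply: eq_bigr => b _; case: (ltngtP j b) => h.
  - have hs : j * (bsize n).*2 + (bsize n).*2 <= b * (bsize n).*2.
      by rewrite -mulSnr leq_mul2r h orbT.
    rewrite (eq_bigr (fun=> 1)); last first.
      move=> y _; rewrite /z /block_start; have := ltn_ord x.
      by case: ltnP => //; lia.
    have /negPf -> : b != j by rewrite -val_eqE /= gtn_eqF.
    by rewrite sum1_card cT mul1n addn0.
  - have hs : b * (bsize n).*2 + (bsize n).*2 <= j * (bsize n).*2.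
      by rewrite -mulSnr leq_mul2r h orbT.
    rewrite big1 ?mul0n; last first.
      move=> y _; rewrite /z /block_start; have := ltn_ord y.
      by case: ltnP => //; lia.
    by have /negPf -> : b != j by rewrite -val_eqE /= ltn_eqF.
  have {h} <- : j = b by apply: val_inj.
  rewrite eqxx mul0n mul1n add0n; rewrite cT aboveE in ax; rewrite -ax.
  by apply: eq_bigr => y _; rewrite ltn_add2l.
rewrite big_split /= -big_distrl /= sum_ltn_ord.
rewrite (bigD1 j) //= eqxx mul1n big1 ?addn0; last by move=> b /negPf ->.
rewrite cS /low_card; have cE : core n = nblocks * bsize n by [].
have kE : nblocks = j.+1 + (nblocks - j.+1) by rewrite subnKC.
move: (nblocks - j.+1) kE => d kE; rewrite kE mulnDl mulSnr in cE.
have : ~~ odd (bsize n) by rewrite odd_double.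
move: (j * bsize n) (d * bsize n) cE => X Y cE ob.
lia.
Qed.

End Node.
End RecSet.

(** * The recursive distribution *)

Section BaseSet.
Variables (n : nat) (e : {ffun 'I_n -> bool}).

Lemma base_elt_subproof (i : 'I_n) : (i.*2 + e i < n.*2)%N.
Proof. by have := ltn_ord i; case: (e i) => /=; lia. Qed.

Definition base_elt (i : 'I_n) : 'I_(n.*2) := Ordinal (base_elt_subproof i).

Lemma base_setE : base_set e = [set base_elt i | i : 'I_n].
Proof.
apply/setP => x; rewrite inE; apply/existsP/imsetP => [[i /eqP xi]|[i _ ->]].
  by exists i => //; apply: val_inj.
by exists i.
Qed.

Lemma base_elt_half (i : 'I_n) : (base_elt i)./2 = i :> nat.
Proof. by rewrite /=; case: (e i) => /=; lia. Qed.

Lemma base_elt_inj : injective base_elt.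
Proof. by move=> i j ij; apply: val_inj; rewrite /= -base_elt_half ij base_elt_half. Qed.

Lemma card_base_set : #|base_set e| = n.
Proof. by rewrite base_setE card_imset ?card_ord //; apply: base_elt_inj. Qed.

Lemma median_base_set (i0 : 'I_n) : i0 = n./2 :> nat -> ~~ odd n ->
  median (base_set e) = (i0.*2 + e i0).+1.
Proof.
move=> i0E on; rewrite (@median_unique _ _ (base_elt i0)) //.
  by rewrite base_setE; apply/imsetP; exists i0.
rewrite aboveE card_base_set base_setE big_imset /=; last first.
  by move=> i j _ _; apply: base_elt_inj.
transitivity (\sum_(i < n) (i0 < i))%N; last first.
  by rewrite sum_ltn_ord i0E; lia.
apply: eq_bigr => i _.
case: (ltngtP i0 i) => h; first by case: (e i0); case: (e i); lia.
  by case: (e i0); case: (e i); lia.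
have -> : i = i0 by apply: val_inj.
by rewrite ltnn.
Qed.

End BaseSet.

Section Distribution.
Variables (R : realType) (m n0 : nat).
Notation core := (core R m n0).
Notation bsize := (bsize R m n0).
Notation nblocks := (nblocks R m n0).
Notation base_case := (base_case R m n0).
Notation low_card := (low_card R m n0).
Notation owner := (owner R m n0).
Notation own := (own R m n0).
Notation Drec := (Drec R m n0).
Notation shift_owner := (shift_owner R m n0).
Hypothesis core_le : forall n, (core n <= n)%N.
Hypothesis node_ok : forall n, base_case n = false ->
  ((core n).*2 <= n)%N /\ (0 < bsize n)%N.
Hypothesis nblocks_gt0 : (0 < nblocks)%N.

Definition shell_prob (n j : nat) (S : {set 'I_(n - core n)}) : R :=
  (#|S| == low_card n j)%:R * 'C(n - core n, low_card n j)%:R^-1.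

Lemma shell_prob_ge0 n j S : 0 <= @shell_prob n j S.
Proof. by rewrite mulr_ge0 ?invr_ge0 ?ler0n. Qed.

Lemma sum_shell_prob n j : base_case n = false -> \sum_S @shell_prob n j S = 1.
Proof.
move=> nb; have [c2 _] := node_ok nb; rewrite -mulr_suml.
have -> : \sum_(S : {set 'I_(n - core n)}) (#|S| == low_card n j)%:R =
   'C(n - core n, low_card n j)%:R :> R.
  rewrite -natr_sum -[in RHS](card_ord (n - core n)) -card_draws -sum1_card; congr _%:R.
  by rewrite [RHS]big_mkcond; apply: eq_bigr => S _; rewrite inE; case: eqP.
by rewrite mulfV // pnatr_eq0 -lt0n bin_gt0 /low_card; lia.
Qed.

Lemma sum_Drec_leaf f n (F : {set 'I_(n.*2)} -> R) : (f == 0%N) || base_case n ->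
  \sum_A Drec f A * F A =
  \sum_(e : {ffun 'I_n -> bool}) 2^-1 ^+ n * F (base_set e).
Proof.
move=> fn; transitivity (\sum_A (\sum_(e : {ffun 'I_n -> bool})
    2^-1 ^+ n * (A == base_set e)%:R) * F A).
  apply: eq_bigr => A _; congr (_ * _).
  by case: f fn => [|f] //= ->.
under [LHS]eq_bigr do rewrite mulr_suml.
rewrite exchange_big; apply: eq_bigr => e _ /=.
rewrite (bigD1 (base_set e)) //= eqxx mulr1 big1 ?addr0 // => A /negPf ->.
by rewrite mulr0 mul0r.
Qed.

Lemma sum_Drec_node f n (F : {set 'I_(n.*2)} -> R) : base_case n = false ->
  \sum_A Drec f.+1 A * F A =
  nblocks%:R^-1 * \sum_(j < nblocks) \sum_S shell_prob j S *
    EE (@Drec f (bsize n)) (fun T : {ffun 'I_nblocks -> _} => F (rec_set S T)).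
Proof.
move=> nb.
transitivity (\sum_A (\sum_(T : {ffun 'I_nblocks -> {set 'I_((bsize n).*2)}})
    (\prod_b Drec f (T b)) * (\sum_(j < nblocks) nblocks%:R^-1 *
    \sum_S shell_prob j S * (A == rec_set S T)%:R)) * F A).
  apply: eq_bigr => A _; congr (_ * _); rewrite /= nb; apply: eq_bigr => T _.
  congr (_ * _); apply: eq_bigr => j _; congr (_ * _).
  rewrite big_mkcond; apply: eq_bigr => S _; rewrite /shell_prob.
  by case: eqP => _; rewrite ?mul1r ?mul0r.
transitivity (\sum_(T : {ffun 'I_nblocks -> {set 'I_((bsize n).*2)}})
    (\prod_b Drec f (T b)) * (\sum_(j < nblocks) nblocks%:R^-1 *
    \sum_S shell_prob j S * F (rec_set S T))).
  under [LHS]eq_bigr do rewrite mulr_suml.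
  rewrite exchange_big; apply: eq_bigr => T _ /=.
  under [LHS]eq_bigr do rewrite -mulrA.
  rewrite -mulr_sumr; congr (_ * _).
  under [LHS]eq_bigr do rewrite mulr_suml.
  rewrite exchange_big; apply: eq_bigr => j _ /=.
  under [LHS]eq_bigr do rewrite -mulrA.
  rewrite -mulr_sumr; congr (_ * _).
  under [LHS]eq_bigr do rewrite mulr_suml.
  rewrite exchange_big; apply: eq_bigr => S _ /=.
  rewrite (bigD1 (rec_set S T)) //= eqxx mulr1 big1 ?addr0 // => A /negPf ->.
  by rewrite mulr0 mul0r.
rewrite mulr_sumr; under [LHS]eq_bigr do rewrite mulr_sumr.
rewrite exchange_big; apply: eq_bigr => j _ /=.
under [LHS]eq_bigr do rewrite mulrCA.
rewrite -mulr_sumr; congr (_ * _).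
under [LHS]eq_bigr do rewrite mulr_sumr.
rewrite exchange_big; apply: eq_bigr => S _ /=.
under [LHS]eq_bigr do rewrite mulrCA.
by rewrite -mulr_sumr.
Qed.

Lemma Drec_ge0 f n (A : {set 'I_(n.*2)}) : 0 <= Drec f A.
Proof.
have base n' (A' : {set 'I_(n'.*2)}) :
    0 <= \sum_(e : {ffun 'I_n' -> bool}) 2^-1 ^+ n' * (A' == base_set e)%:R :> R.
  by apply: sumr_ge0 => e _; rewrite mulr_ge0 ?exprn_ge0 ?invr_ge0 ?ler0n.
elim: f n A => [|f IH] n A /=; first exact: base.
case: ifP => _; first exact: base.
apply: sumr_ge0 => T _; rewrite mulr_ge0 ?prodr_ge0 //.
apply: sumr_ge0 => j _; rewrite mulr_ge0 ?invr_ge0 ?ler0n //.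
by apply: sumr_ge0 => S _; rewrite mulr_ge0 ?invr_ge0 ?ler0n.
Qed.

Lemma sum_half n : \sum_(e : {ffun 'I_n -> bool}) 2^-1 ^+ n = 1 :> R.
Proof.
rewrite sumr_const card_ffun card_bool card_ord -[_ *+ _]mulr_natr natrX.
by rewrite -exprMn mulVf ?expr1n // pnatr_eq0.
Qed.

Lemma sum_Drec f n : \sum_(A : {set 'I_(n.*2)}) Drec f A = 1.
Proof.
elim: f n => [|f IH] n; under eq_bigr do rewrite -[Drec _ _]mulr1.
  rewrite sum_Drec_leaf //; under eq_bigr do rewrite mulr1; exact: sum_half.
have [nb|nb] := boolP (base_case n).
  rewrite sum_Drec_leaf //; under eq_bigr do rewrite mulr1; exact: sum_half.
rewrite sum_Drec_node ?(negPf nb) //.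
under eq_bigr do (under eq_bigr do rewrite EE_const //).
under eq_bigr do (under eq_bigr do rewrite mulr1).
under eq_bigr do rewrite sum_shell_prob ?(negPf nb) //.
by rewrite sumr_const card_ord -mulr_natr mul1r mulVf // pnatr_eq0 -lt0n.
Qed.

Lemma eq_EE (Om : finType) k (mu : Om -> R) (F G : {ffun 'I_k -> Om} -> R) :
  (forall T : {ffun 'I_k -> Om}, (forall b, mu (T b) != 0) -> F T = G T) -> EE mu F = EE mu G.
Proof.
move=> FG; apply: eq_bigr => T _; have [h|] := boolP [forall b, mu (T b) != 0].
  by rewrite FG //; apply/forallP.
by move=> /forallPn[b]; rewrite negbK => /eqP h; rewrite (bigD1 b) //= h !mul0r.
Qed.

Lemma Drec_card f n (A : {set 'I_(n.*2)}) : Drec f A != 0 -> #|A| = n.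
Proof.
(* As the vanishing of a sum of nonnegative terms, the claim can be unfolded with
   [sum_Drec_node]. *)
suff H : \sum_(A : {set 'I_(n.*2)}) Drec f A * (#|A| != n)%:R = 0.
  have := psumr_eq0P _ H => /(_ _ A isT) H0.
  move=> D0; apply/eqP; apply: contraTT D0 => cA; rewrite negbK.
  have := H0 (fun A' _ => mulr_ge0 (Drec_ge0 f A') (ler0n _ _)).
  by rewrite cA mulr1 => ->.
have leaf n' (e : {ffun 'I_n' -> bool}) : 2^-1 ^+ n' * (#|base_set e| != n')%:R = 0 :> R.
  by rewrite card_base_set eqxx mulr0.
elim: f n {A} => [|f IH] n; first by rewrite sum_Drec_leaf // big1.
have [nb|/negPf nb] := boolP (base_case n); first by rewrite sum_Drec_leaf // big1.
rewrite sum_Drec_node // big1 ?mulr0 // => j _; rewrite big1 // => S _.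
rewrite (@eq_EE _ _ _ _ (fun=> 0)); first by rewrite EE_const ?mulr0 // sum_Drec.
move=> T hT; rewrite (card_rec_set core_le) ?eqxx // => b.
apply/eqP; apply: contraTT (hT b) => cb; rewrite negbK; apply/eqP.
have := psumr_eq0P _ (IH (bsize n)) => /(_ _ (T b) isT); rewrite cb mulr1; apply.
by move=> A _; rewrite mulr_ge0 ?Drec_ge0 ?ler0n.
Qed.

(** True when the player [true] is the charged one, the median's pair being held by the other
    player; [.-1] returns to zero-based elements. *)
Definition charged (f n : nat) (P : nat -> bool) (A : {set 'I_(n.*2)}) : bool :=
  ~~ owner f n P (median A).-1.

Lemma odd_median_rec_set n (S : {set 'I_(n - core n)})
    (T : {ffun 'I_nblocks -> {set 'I_((bsize n).*2)}}) (j : 'I_nblocks) :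
  base_case n = false -> (forall b, #|T b| = bsize n) -> ~~ odd n ->
  #|S| = low_card n j -> odd (median (rec_set S T)) = odd (median (T j)).
Proof.
move=> nb cT on cS; have [c2 bs0] := node_ok nb.
rewrite (median_rec_set core_le cT on c2 bs0 cS) oddD /block_start oddD.
rewrite oddM odd_double andbF addbF oddB //.
by rewrite /core oddM odd_double andbF (negPf on).
Qed.

Lemma charged_rec_set f n P (S : {set 'I_(n - core n)})
    (T : {ffun 'I_nblocks -> {set 'I_((bsize n).*2)}}) (j : 'I_nblocks) :
  base_case n = false -> (forall b, #|T b| = bsize n) -> ~~ odd n ->
  #|S| = low_card n j ->
  charged f.+1 P (rec_set S T) = charged f (shift_owner n j P) (T j).
Proof.
move=> nb cT on cS; have [c2 bs0] := node_ok nb.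
rewrite /charged (median_rec_set core_le cT on c2 bs0 cS).
have [|x [_ _ ->]] := @medianP _ (T j); first by rewrite cT.
by rewrite addnS /= (owner_block core_le _ nb).
Qed.

Definition glue f n P pl (S : {set 'I_(n - core n)})
    (u : {ffun 'I_nblocks -> {set 'I_((bsize n).*2)}}) : {set 'I_(n.*2)} :=
  own f.+1 P pl (rec_set S u).

Definition input f n P pl (b : 'I_nblocks) : {set 'I_((bsize n).*2)} ->
  {set 'I_((bsize n).*2)} := own f (shift_owner n b P) pl.

(** The distribution in the form required by [elimination]: independent blocks, a shell depending on
    [j], and a label read off block [j] alone. *)
Lemma sum_Drec_game f n P
    (F : {set 'I_(n.*2)} -> {set 'I_(n.*2)} -> bool -> bool -> R) :
  base_case n = false -> ~~ odd n ->
  \sum_A Drec f.+1 A * F (own f.+1 P true A) (own f.+1 P false A)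
      (odd (median A)) (charged f.+1 P A) =
  nblocks%:R^-1 * \sum_(j < nblocks) \sum_S shell_prob j S *
    EE (@Drec f (bsize n)) (fun T =>
      F (glue f P true (S :&: share (n - core n) P true) (UU (@input f n P true) T))
        (glue f P false (S :&: share (n - core n) P false) (UU (@input f n P false) T))
        (odd (median (T j))) (charged f (shift_owner n j P) (T j))).
Proof.
move=> nb on; rewrite (@sum_Drec_node f n (fun A => F (own f.+1 P true A)
  (own f.+1 P false A) (odd (median A)) (charged f.+1 P A))) //.
congr (_ * _); apply: eq_bigr => j _; apply: eq_bigr => S _.
rewrite /shell_prob; case: eqP => [cS|_]; last by rewrite !mul0r.
congr (_ * _); apply: eq_EE => T hT.
have cT b : #|T b| = bsize n by apply: Drec_card (hT b).
rewrite (odd_median_rec_set nb cT on cS) (charged_rec_set f P nb cT on cS).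
by rewrite (own_rec_set core_le f P true S T nb)
  (own_rec_set core_le f P false S T nb).
Qed.

Lemma owner_leaf f n P x : (f == 0%N) || base_case n -> owner f n P x = P x./2.
Proof. by case: f => [|f] //= nb; rewrite /owner /= nb. Qed.

(** Flipping the choice in the median's pair preserves the measure and the input of the player who
    lacks this pair, but changes the parity of the median. So any answer fails on exactly one of the
    two sets. *)
Lemma silent_error_leaf f n P (a : {set 'I_(n.*2)} -> bool) :
  (f == 0%N) || base_case n -> ~~ odd n -> (0 < n)%N ->
  2^-1 * (\sum_(A : {set 'I_(n.*2)}) Drec f A * (charged f P A)%:R) <=
  \sum_(A : {set 'I_(n.*2)}) Drec f A *
    (charged f P A && (a (own f P true A) != odd (median A)))%:R.
Proof.
move=> fn on n1; rewrite !sum_Drec_leaf //.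
have hi0 : (n./2 < n)%N by lia.
pose i0 : 'I_n := Ordinal hi0.
have med (e : {ffun 'I_n -> bool}) := @median_base_set n e i0 erefl on.
have ch (e : {ffun 'I_n -> bool}) : charged f P (base_set e) = ~~ P i0.
  by rewrite /charged med owner_leaf // -[(_ + _).+1.-1]/(nat_of_ord (base_elt e i0)) base_elt_half.
have [Pi0|Pi0] := boolP (P i0).
  rewrite !big1 ?mulr0 // => e _; rewrite ch Pi0 mulr0 //.
have own_sub (e e' : {ffun 'I_n -> bool}) : (forall i, i != i0 -> e i = e' i) ->
    own f P true (base_set e) \subset own f P true (base_set e').
  move=> ee; apply/subsetP => x; rewrite !in_own => /andP[]; rewrite base_setE.
  case/imsetP => i _ ->; rewrite owner_leaf // base_elt_half => /eqP Pi.
  rewrite Pi eqxx andbT base_setE; apply/imsetP; exists i => //.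
  apply: val_inj; rewrite /= ee //; apply: contraTneq Pi => ->.
  by rewrite (negPf Pi0).
pose flip (e : {ffun 'I_n -> bool}) := upd e i0 (~~ e i0).
have flipK : involutive flip.
  by move=> e; rewrite /flip upd_same upd_upd negbK upd_id.
have own_flip (e : {ffun 'I_n -> bool}) :
    own f P true (base_set (flip e)) = own f P true (base_set e).
  apply/eqP; rewrite eqEsubset !own_sub // => i /negPf ii0; rewrite ffunE ii0 //.
under eq_bigr do rewrite ch Pi0 mulr1.
rewrite sum_half mulr1.
pose G (e : {ffun 'I_n -> bool}) : R := 2^-1 ^+ n * (a (own f P true (base_set e)) != ~~ e i0)%:R.
rewrite [leRHS](_ : _ = \sum_e G e); last first.
  apply: eq_bigr => e _; rewrite ch Pi0 /= med /= oddD odd_double /=.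
  by rewrite /G; case: (e i0).
have -> : \sum_e G e = 2^-1 * \sum_e (G e + G (flip e)).
  have re : \sum_e G (flip e) = \sum_e G e.
    by rewrite [RHS](reindex_inj (inv_inj flipK)).
  by rewrite big_split /= re; lra.
rewrite (eq_bigr (fun=> 2^-1 ^+ n)) ?sum_half ?mulr1 // => e _.
rewrite /G own_flip /flip upd_same -mulrDr -[RHS]mulr1; congr (_ * _).
by case: (a _); case: (e i0); rewrite /= ?addr0 ?add0r.
Qed.

(* Without communication the bit is uniform given the input of a player who
   does not hold the pair of the median. *)
Lemma silent_error f n P (a : {set 'I_(n.*2)} -> bool) : ~~ odd n -> (0 < n)%N ->
  2^-1 * (\sum_(A : {set 'I_(n.*2)}) Drec f A * (charged f P A)%:R) <=
  \sum_(A : {set 'I_(n.*2)}) Drec f A *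
    (charged f P A && (a (own f P true A) != odd (median A)))%:R.
Proof.
elim: f n P a => [|f IH] n P a on n1.
  exact: silent_error_leaf.
have [nb|/negPf nb] := boolP (base_case n).
  by apply: silent_error_leaf; rewrite ?nb ?orbT.
have [c2 bs0] := node_ok nb.
rewrite (@sum_Drec_game f n P (fun _ _ _ z => z%:R)) //.
rewrite (@sum_Drec_game f n P (fun x _ l z => (z && (a x != l))%:R)) //.
rewrite mulrCA; apply: ler_wpM2l; first by rewrite invr_ge0 ler0n.
rewrite mulr_sumr; apply: ler_sum => j _.
rewrite mulr_sumr; apply: ler_sum => S _.
rewrite mulrCA; apply: ler_wpM2l; first exact: shell_prob_ge0.
(* With the shell and all blocks but [j] fixed, [a] becomes an answering rule for the embedded
   instance. *)
rewrite (@EE_upd _ _ _ _ (sum_Drec f (bsize n)) j).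
rewrite [leRHS](@EE_upd _ _ _ _ (sum_Drec f (bsize n)) j).
rewrite -EEZ; apply: EE_le => [A|T]; first exact: Drec_ge0.
under eq_bigr do rewrite upd_same.
under [leRHS]eq_bigr do rewrite upd_same UU_upd.
apply: (IH (bsize n) (shift_owner n j P) (fun x => a (glue f P true _ (upd _ j x)))).
- by rewrite odd_double.
- exact: bs0.
Qed.

End Distribution.

(** * Hypergeometric deviations *)

Section Moments.
Local Open Scope nat_scope.

(** Absorption, [u C(a, u) = a C(a - 1, u - 1)], followed by Vandermonde's identity. *)
Lemma hyper_mean a c L :
  (a + c) * \sum_(u < L.+1) u * ('C(a, u) * 'C(c, L - u)) =
  a * L * 'C(a + c, L).
Proof.
case: L => [|L]; first by rewrite big_ord_recl big_ord0 !muln0.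
rewrite big_ord_recl mul0n add0n.
have -> : \sum_(i < L.+1) bump 0 i * ('C(a, bump 0 i) * 'C(c, L.+1 - bump 0 i)) =
    a * 'C(a.-1 + c, L).
  rewrite -binomial.Vandermonde big_distrr; apply: eq_bigr => i _ /=.
  by rewrite /bump /= add1n subSS !mulnA mul_bin_diag.
case: a => [|a]; first by rewrite !mul0n muln0.
by rewrite mulnCA -mulnA -mul_bin_diag addSn.
Qed.

Lemma hyper_moment2 a c L :
  (a + c) * ((a + c).-1 * \sum_(u < L.+1) u * u.-1 * ('C(a, u) * 'C(c, L - u))) =
  a * a.-1 * (L * L.-1) * 'C(a + c, L).
Proof.
case: L => [|L]; first by rewrite big_ord_recl big_ord0 !muln0 // !mul0n !muln0.
rewrite big_ord_recl !mul0n add0n.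
have -> : \sum_(i < L.+1) bump 0 i * (bump 0 i).-1 *
    ('C(a, bump 0 i) * 'C(c, L.+1 - bump 0 i)) =
    a * \sum_(i < L.+1) i * ('C(a.-1, i) * 'C(c, L - i)).
  rewrite big_distrr; apply: eq_bigr => i _ /=.
  rewrite /bump /= add1n subSS /=.
  have := mul_bin_diag a i => e; transitivity (i * (i.+1 * 'C(a, i.+1)) * 'C(c, L - i)).
    by ring.
  by rewrite -e; ring.
case: a => [|a]; first by rewrite !mul0n !muln0.
have h := hyper_mean a c L; have e : (a + c).+1 * 'C(a + c, L) = _ := mul_bin_diag _ _.
rewrite addSn /=; transitivity (a.+1 * a * L * ((a + c).+1 * 'C(a + c, L))).
  by transitivity (a.+1 * (a + c).+1 * (a * L * 'C(a + c, L))); [rewrite -h; ring | ring].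
by rewrite e; ring.
Qed.

(** In the nondegenerate case this amounts to [(a + c)(a - 1)(L - 1) <= (a + c - 1) a L], true since
    [L <= a + c]. *)
Lemma hyper_moment2_le a c L :
  (a + c) ^ 2 * \sum_(u < L.+1) u * u.-1 * ('C(a, u) * 'C(c, L - u)) <=
  (a * L) ^ 2 * 'C(a + c, L).
Proof.
have := hyper_moment2 a c L; set M := \sum_(u < _) _; set C := 'C(_, _) => h.
have [n1|n2] := leqP (a + c) 1.
  rewrite /M big1 ?muln0 // => -[[|[|u]] uL] _ //=.
  by rewrite bin_small ?mul0n ?muln0 //; lia.
have [nL|Ln] := ltnP (a + c) L.
  rewrite {1}/C bin_small // muln0 leqn0 muln_eq0; apply/orP; right.
  have C0 : C = 0 by rewrite /C bin_small.
  have : (a + c) * ((a + c).-1 * M) == 0 by rewrite h C0 muln0.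
  by rewrite !muln_eq0 => /or3P[/eqP|/eqP|] //; lia.
have n0 : 0 < (a + c).-1 by lia.
rewrite -(leq_pmul2l n0).
have -> : (a + c).-1 * ((a + c) ^ 2 * M) = (a + c) * ((a + c) * ((a + c).-1 * M)).
  by ring.
rewrite h.
have [->|a0] := posnP a; first by rewrite !mul0n muln0.
have [->|L0] := posnP L; first by rewrite !mul0n !muln0.
have k : (a + c) * (a.-1 * L.-1) <= (a + c).-1 * (a * L).
  clear h n2 Ln n0; move: @M @C => _ _; case: a a0 => // a _; case: L L0 => // L _ /=; nia.
have := leq_mul (leqnn (a * L * C)) k; congr (_ <= _); ring.
Qed.

End Moments.

Section Deviation.
Variable R : realFieldType.

(** With [u^2 = u (u - 1) + u] and the bound on the second factorial moment, the variance is at most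
    the mean [a L / (a + c)]; everything is scaled to avoid divisions. *)
Lemma hyper_variance (a c L : nat) :
  \sum_(u < L.+1) ('C(a, u) * 'C(c, L - u))%:R *
    (u%:R * (a + c)%:R - a%:R * L%:R) ^+ 2 <=
  a%:R * L%:R * (a + c)%:R * 'C(a + c, L)%:R :> R.
Proof.
set n := (a + c)%N; set C := 'C(n, L).
pose w (u : nat) : R := ('C(a, u) * 'C(c, L - u))%:R.
have m0 : \sum_(u < L.+1) w u = C%:R.
  by rewrite -natr_sum binomial.Vandermonde.
have m1 : n%:R * (\sum_(u < L.+1) u%:R * w u) = a%:R * L%:R * C%:R.
  have := congr1 (fun x => x%:R : R) (hyper_mean a c L).
  rewrite !natrM natr_sum => <-; congr (_ * _).
  by apply: eq_bigr => u _; rewrite natrM.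
have m2 : n%:R ^+ 2 * (\sum_(u < L.+1) (u * u.-1)%:R * w u) <=
   (a%:R * L%:R) ^+ 2 * C%:R.
  have := hyper_moment2_le a c L; rewrite -(ler_nat R) 2!natrM natr_sum.
  rewrite natrX natrX natrM; congr (_ * _ <= _).
  by apply: eq_bigr => u _; rewrite natrM.
have -> : \sum_(u < L.+1) w u * (u%:R * n%:R - a%:R * L%:R) ^+ 2 =
    n%:R ^+ 2 * (\sum_(u < L.+1) (u * u.-1)%:R * w u) +
    (n%:R - 2 * a%:R * L%:R) * (n%:R * \sum_(u < L.+1) u%:R * w u) +
    (a%:R * L%:R) ^+ 2 * \sum_(u < L.+1) w u.
  rewrite !mulr_sumr -!big_split; apply: eq_bigr => -[u uL] _ /=.
  rewrite natrM; case: u uL => [|u] uL /=; first by ring.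
  by rewrite -natr1; ring.
rewrite m0 m1; lra.
Qed.


Section Subsets.
Variables (T : finType) (P : {set T}) (K : nat).

(** The sets [S] are grouped by their trace [s] on [P]; the other [K - #|s|] elements are chosen
    freely outside [P]. *)
Lemma sum_fixed_card (D : {set T} -> R) :
  \sum_(S : {set T} | #|S| == K) D (S :&: P) =
  \sum_(s : {set T} | (s \subset P) && (#|s| <= K)%N)
    'C(#|~: P|, K - #|s|)%:R * D s.
Proof.
rewrite (partition_big (fun S => S :&: P)
  (fun s => (s \subset P) && (#|s| <= K)%N)) /=; last first.
  by move=> S /eqP <-; rewrite subsetIr subset_leq_card ?subsetIl.
apply: eq_bigr => s /andP[sP sK].
rewrite (eq_bigr (fun=> D s)); last by move=> S /andP[_ /eqP ->].
rewrite sumr_const -[_ *+ _]mulr_natl; congr (_%:R * _).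
rewrite -cards_draws -[RHS](card_in_imset (f := fun B => s :|: B)).
  apply: eq_card => S;  apply/idP/imsetP => [/andP[/eqP cS /eqP SP]|[B]].
    exists (S :\: P); last by rewrite -SP setID.
    rewrite !inE subsetDr /= cardsD SP cS //.
  rewrite inE => /andP[BP /eqP cB] ->.
  have dB : B :&: P = set0 by apply/eqP; rewrite -subset0 -(setICr P) setIC setIS.
  have sB : s :&: B = set0.
    by apply/eqP; rewrite -subset0 -dB setIC setIS.
  apply/andP; rewrite cardsU sB cards0 subn0 cB subnKC // eqxx; split => //.
  by rewrite setIUl dB setU0; apply/eqP/setIidPl.
move=> B B'; rewrite !inE => /andP[BP _] /andP[BP' _] eB.
have key (C : {set T}) : C \subset ~: P -> (s :|: C) :\: P = C.
  move=> CP; rewrite setDUl (_ : s :\: P = set0) ?set0U; last first.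
    by apply/eqP; rewrite setD_eq0.
  by apply/setDidPl; rewrite disjoints_subset.
by rewrite -(key _ BP) eB key.
Qed.

Lemma sum_subset_card (w : nat -> R) :
  \sum_(s : {set T} | (s \subset P) && (#|s| <= K)%N) w #|s| =
  \sum_(u < K.+1) 'C(#|P|, u)%:R * w u.
Proof.
rewrite (partition_big (fun s : {set T} => inord #|s| : 'I_K.+1) xpredT) //=.
apply: eq_bigr => u _.
rewrite (eq_bigl (fun s : {set T} => s \in [set s : {set T} | s \subset P & #|s| == u])).
  rewrite -cards_draws (eq_bigr (fun=> w u)); first by rewrite sumr_const mulr_natl.
  by move=> s; rewrite inE => /andP[_ /eqP ->].
move=> s; rewrite inE -andbA; congr (_ && _).
apply/andP/eqP => [[sK /eqP <-]|->]; first by rewrite inordK.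
by rewrite -ltnS ltn_ord inord_val.
Qed.

End Subsets.

(** * Traces of random sets of neighbouring cardinalities *)

Definition trace_mean (T : finType) (P : {set T}) (K : nat)
    (D : {set T} -> R) : R :=
  \sum_(S : {set T} | #|S| == K) 'C(#|T|, K)%:R^-1 * D (S :&: P).

(** The probabilities of a fixed trace of [u] elements at cardinalities [K] and [K + 1] differ by a
    multiple of the deviation of [u] from the mean of a hypergeometric variable with [K + 1] draws
    from [N + 1] points, so the variance bound applies. The [if] covers [u = K + 1], where truncated
    subtraction would give a binomial equal to one. *)
Lemma bin_diff (N a K u : nat) : (a <= N)%N -> (K < N)%N -> (u <= K.+1)%N ->
  (if (u <= K)%N then 'C(N - a, K - u)%:R else 0) / 'C(N, K)%:R -
    'C(N - a, K.+1 - u)%:R / 'C(N, K.+1)%:R =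
  'C((N - a).+1, K.+1 - u)%:R * (a%:R * K.+1%:R - u%:R * N.+1%:R) /
    ((N - a).+1%:R * (N - K)%:R * 'C(N, K)%:R) :> R.
Proof.
move=> aN KN uK.
have C0 : 'C(N, K)%:R != 0 :> R by rewrite pnatr_eq0 -lt0n bin_gt0 ltnW.
have NK : (N - K)%:R != 0 :> R by rewrite pnatr_eq0 -lt0n subn_gt0.
have b0 : (N - a).+1%:R != 0 :> R by rewrite pnatr_eq0.
have K0 : K.+1%:R != 0 :> R by rewrite pnatr_eq0.
have e1 : 'C(N, K.+1)%:R = (N - K)%:R * 'C(N, K)%:R / K.+1%:R :> R.
  by rewrite -natrM -mul_bin_left natrM mulrC mulKf.
rewrite e1.
have e2 : (if (u <= K)%N then 'C(N - a, K - u)%:R else 0) =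
   (K.+1%:R - u%:R) * 'C((N - a).+1, K.+1 - u)%:R / (N - a).+1%:R :> R.
  case: leqP => [uK1|uK2]; last first.
    have -> : u = K.+1 by lia.
    by rewrite subrr mul0r mul0r.
  rewrite -natrB // (subSn (m := u)) // -natrM -mul_bin_diag /= natrM mulrAC.
  by rewrite mulfV // mul1r.
have e3 : 'C(N - a, K.+1 - u)%:R = 'C((N - a).+1, K.+1 - u)%:R -
    (if (u <= K)%N then 'C(N - a, K - u)%:R else 0) :> R.
  case: leqP => [uK1|uK2].
    by rewrite (subSn (m := u)) // binS natrD addrK.
  have -> : u = K.+1 by lia.
  by rewrite subnn !bin0 subr0.
rewrite e3 e2.
have cN : N.+1%:R = (N - a).+1%:R + a%:R :> R by rewrite -natrD addSn subnK.
have cK : N.+1%:R = (N - K)%:R + K.+1%:R :> R by rewrite -natrD addnS subnK // ltnW.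
have cb : (N - a).+1%:R = (N - K)%:R + K.+1%:R - a%:R :> R by rewrite -cK cN addrK.
move: b0; rewrite cb cK => b0.
by field; rewrite nat1r C0 NK b0 K0.
Qed.

(** By [bin_diff] the change is at most a mean absolute deviation. It is bounded through
    [|x| <= x^2 / (2 B) + B / 2], with [B^2] at least the scaled variance, in place of the
    Cauchy-Schwarz inequality. *)
Lemma trace_mean_step (T : finType) (P : {set T}) (K : nat) (D : {set T} -> R)
    (B : R) : (forall s, 0 <= D s <= 2) -> (K < #|T|)%N -> 0 < B ->
  #|P|%:R * K.+1%:R * #|T|.+1%:R <= B ^+ 2 ->
  trace_mean P K D <= trace_mean P K.+1 D +
    2 * (B * #|T|.+1%:R / (K.+1%:R * (#|T| - #|P|).+1%:R * (#|T| - K)%:R)).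
Proof.
move=> D2 KN B0 hB; set N := #|T|; set a := #|P|.
have aN : (a <= N)%N by apply: max_card.
have cP : #|~: P| = (N - a)%N by rewrite /N -(cardsC P) addKn.
rewrite -lerBlDl /trace_mean -!mulr_sumr !sum_fixed_card cP -/N.
have -> : \sum_(s : {set T} | (s \subset P) && (#|s| <= K)%N)
      'C(N - a, K - #|s|)%:R * D s =
   \sum_(s : {set T} | (s \subset P) && (#|s| <= K.+1)%N)
      (if (#|s| <= K)%N then 'C(N - a, K - #|s|)%:R else 0) * D s :> R.
  rewrite big_mkcond [RHS]big_mkcond; apply: eq_bigr => s _.
  case: (s \subset P) => //=; case: (leqP #|s| K) => h; first by rewrite leqW.
  by rewrite mul0r if_same.
rewrite !mulr_sumr -sumrB.
have n0 : 0 < (N - a).+1%:R * (N - K)%:R * 'C(N, K)%:R :> R.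
  by rewrite !mulr_gt0 ?ltr0n ?subn_gt0 // bin_gt0 ltnW.
pose x (u : nat) : R := u%:R * N.+1%:R - a%:R * K.+1%:R.
pose w (u : nat) : R := 'C((N - a).+1, K.+1 - u)%:R.
apply: (@le_trans _ _ (\sum_(s : {set T} | (s \subset P) && (#|s| <= K.+1)%N)
   (w #|s| * `|x #|s| |) * (2 / ((N - a).+1%:R * (N - K)%:R * 'C(N, K)%:R)))).
  apply: ler_sum => s /andP[sP sK].
  have /andP[Ds0 Ds2] := D2 s.
  rewrite !mulrA -mulrBl [_^-1 * _]mulrC ['C(N, K.+1)%:R^-1 * _]mulrC bin_diff //.
  apply: le_trans (ler_norm _) _; rewrite normrM (ger0_norm Ds0).
  rewrite normrM normrM ger0_norm ?ler0n // normfV (gtr0_norm n0).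
  rewrite -[_ - _ in X in X <= _]opprB normrN -/(x _) -/(w _).
  rewrite [_ * 2 / _]mulrAC ler_wpM2l //.
  by rewrite !mulr_ge0 ?invr_ge0 ?(ltW n0) ?ler0n.
rewrite -mulr_suml (sum_subset_card P K.+1 (fun u => w u * `|x u|)) -/a.
have H : \sum_(u < K.+2) 'C(a, u)%:R * (w u * `|x u|) <= B * 'C(N.+1, K.+1)%:R.
  have am u : `|x u| <= x u ^+ 2 / (2 * B) + B / 2.
    have h := sqr_ge0 (`|x u| - B); rewrite sqrrB real_normK ?num_real // in h.
    rewrite -subr_ge0; have -> : x u ^+ 2 / (2 * B) + B / 2 - `|x u| =
      (x u ^+ 2 - `|x u| * B *+ 2 + B ^+ 2) / (2 * B) by field; rewrite gt_eqF.
    by rewrite divr_ge0 // mulr_ge0 ?ltW.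
  have v := hyper_variance a (N - a).+1 K.+1.
  have aNE : (a + (N - a).+1 = N.+1)%N by rewrite addnS subnKC.
  rewrite aNE in v.
  have m0 : \sum_(u < K.+2) 'C(a, u)%:R * w u = 'C(N.+1, K.+1)%:R.
    rewrite -aNE -binomial.Vandermonde natr_sum; apply: eq_bigr => u _.
    by rewrite natrM.
  apply: (@le_trans _ _ (\sum_(u < K.+2) ('C(a, u)%:R * w u * x u ^+ 2 / (2 * B)
     + 'C(a, u)%:R * w u * (B / 2)))).
    apply: ler_sum => u _; rewrite mulrA -[_ / (2 * B)]mulrA -mulrDr.
    by apply: ler_wpM2l => //; rewrite mulr_ge0 ?ler0n.
  rewrite big_split -!mulr_suml /= m0.
  have v2 : (\sum_(u < K.+2) 'C(a, u)%:R * w u * x u ^+ 2) / (2 * B) <=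
      B * 'C(N.+1, K.+1)%:R / 2.
    rewrite ler_pdivrMr ?mulr_gt0 //.
    apply: (@le_trans _ _ (B ^+ 2 * 'C(N.+1, K.+1)%:R)); last first.
      by rewrite le_eqVlt; apply/orP; left; apply/eqP; field.
    apply: le_trans (_ : a%:R * K.+1%:R * N.+1%:R * 'C(N.+1, K.+1)%:R <= _).
      apply: le_trans v; apply: ler_sum => u _; by rewrite natrM.
    by rewrite ler_wpM2r.
  by apply: le_trans (lerD v2 (lexx _)) _; lra.
apply: le_trans (ler_wpM2r _ H) _; first by rewrite divr_ge0 // ltW.
have C0 : 'C(N, K)%:R != 0 :> R by rewrite pnatr_eq0 -lt0n bin_gt0 ltnW.
have NK : (N - K)%:R != 0 :> R by rewrite pnatr_eq0 -lt0n subn_gt0.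
have b0 : (N - a).+1%:R != 0 :> R by rewrite pnatr_eq0.
have K0 : K.+1%:R != 0 :> R by rewrite pnatr_eq0.
have e : 'C(N.+1, K.+1)%:R = N.+1%:R * 'C(N, K)%:R / K.+1%:R :> R.
  by rewrite -natrM (mul_bin_diag N.+1) natrM mulrAC mulfV ?mul1r.
rewrite e le_eqVlt; apply/orP; left; apply/eqP.
by field; rewrite !nat1r C0 NK b0 K0.
Qed.

Lemma trace_mean_steps (T : finType) (P : {set T}) (K d : nat)
    (D : {set T} -> R) (eta : R) :
  (forall i, (K <= i < K + d)%N -> trace_mean P i D <= trace_mean P i.+1 D + eta) ->
  trace_mean P K D <= trace_mean P (K + d) D + d%:R * eta.
Proof.
elim: d => [|d IH] h; first by rewrite addn0 mul0r addr0.
apply: le_trans (IH _) _.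
  by move=> i /andP[Ki id]; apply: h; rewrite Ki addnS ltnS ltnW.
rewrite -natr1 mulrDl mul1r addnS (addrC (_ * _)) addrA lerD2r; apply: h.
by rewrite leq_addr addnS ltnSn.
Qed.

(** * Balance of a random partition on a fixed set of pairs *)

Definition unbalanced (N : nat) (P : nat -> bool) : bool :=
  ~~ ((N <= 4 * #|share N P true|) && (4 * #|share N P true| <= 3 * N))%N.

(** Chebyshev's inequality: failure puts [#|S :&: B|] more than [N / 4] away from its mean [N / 2],
    whence the factor 16, and [K] is half of [n]. *)
Lemma unbalanced_rare (T : finType) (B : {set T}) (K : nat) :
  #|T| = K.*2 -> (0 < #|B|)%N ->
  \sum_(S : {set T} | #|S| == K) 'C(#|T|, K)%:R^-1 *
    (~~ ((#|B| <= 4 * #|S :&: B|) && (4 * #|S :&: B| <= 3 * #|B|))%N)%:R <=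
  8 / #|B|%:R :> R.
Proof.
move=> TK B0; set N := #|B|; set n := #|T|.
have BT : (N <= n)%N by apply: max_card.
have n0 : (0 < n)%N by apply: leq_trans BT.
have [nR NR] : 0 < n%:R :> R /\ 0 < N%:R :> R by rewrite !ltr0n.
have nK : n%:R = 2 * K%:R :> R by rewrite /n TK -muln2 natrM mulrC.
have cB : #|~: B| = (n - N)%N by rewrite /n -(cardsC B) addKn.
have C0 : 0 < 'C(n, K)%:R :> R by rewrite ltr0n bin_gt0 /n TK; lia.
pose x (u : nat) : R := u%:R * n%:R - N%:R * K%:R.
apply: (@le_trans _ _ (\sum_(S : {set T} | #|S| == K) 'C(n, K)%:R^-1 *
   (x #|S :&: B| ^+ 2 * (16 / (n%:R * N%:R) ^+ 2)))).
  apply: ler_sum => S _; apply: ler_wpM2l; first by rewrite invr_ge0 ler0n.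
  case: andP => [//|h] /=; first by rewrite mulr_ge0 ?sqr_ge0 ?divr_ge0 ?sqr_ge0.
  rewrite mulrA ler_pdivlMr ?exprn_gt0 ?mulr_gt0 // mul1r.
  set u := #|S :&: B| in h *; rewrite /x nK.
  have : (4 * u < N)%N \/ (3 * N < 4 * u)%N by lia.
  have K0 : 0 < K%:R :> R by lra.
  have -> : (2 * K%:R * N%:R) ^+ 2 = K%:R ^+ 2 * (4 * N%:R ^+ 2) :> R by ring.
  have -> : (u%:R * (2 * K%:R) - N%:R * K%:R) ^+ 2 * 16 =
    K%:R ^+ 2 * (16 * (2 * u%:R - N%:R) ^+ 2) :> R by ring.
  rewrite ler_pM2l ?exprn_gt0 // => -[]; rewrite -(ltr_nat R) !natrM => h2; nra.
rewrite -mulr_sumr -(mulr_suml _ _ (fun S => x #|S :&: B| ^+ 2)).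
rewrite (sum_fixed_card B K (fun s => x #|s| ^+ 2)).
rewrite (sum_subset_card B K (fun u => 'C(#|~: B|, K - u)%:R * x u ^+ 2)) cB -/N.
have v := hyper_variance N (n - N) K; rewrite subnKC // in v.
apply: (@le_trans _ _ ('C(n, K)%:R^-1 * ((N%:R * K%:R * n%:R * 'C(n, K)%:R) *
    (16 / (n%:R * N%:R) ^+ 2)))).
  apply: ler_wpM2l; first by rewrite invr_ge0 ltW.
  apply: ler_wpM2r; first by rewrite divr_ge0 ?sqr_ge0.
  by apply: le_trans v; apply: ler_sum => u _; rewrite natrM mulrA.
rewrite le_eqVlt; apply/orP; left; apply/eqP; rewrite nK.
by field; rewrite !gt_eqF //; lra.
Qed.

End Deviation.

(** * Protocols and round elimination *)

(** The alphabet may vary with the round, since elimination merges a message with the next one into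
    a product alphabet. The first type is the input of the next speaker, so the roles swap after
    each message. *)
Fixpoint prot (X Y : finType) (Ms : seq finType) : Type :=
  if Ms is M :: Ms' then ((X -> M) * (M -> prot Y X Ms'))%type
  else ((X -> bool) * (Y -> bool))%type.

(* Only one player is charged for a wrong answer, and [z] tells whether this is
   the player who speaks first. *)
Fixpoint cost (X Y : finType) (Ms : seq finType) :
    prot X Y Ms -> X -> Y -> bool -> bool -> bool :=
  if Ms is M :: Ms' then
    fun p x y l z => cost (p.2 (p.1 x)) y x l (~~ z)
  else fun p x y l z => if z then p.1 x != l else p.2 y != l.

Fixpoint prot_comp (X X' Y Y' : finType) (g : X -> X') (h : Y -> Y')
    (Ms : seq finType) : prot X' Y' Ms -> prot X Y Ms :=
  if Ms is M :: Ms' then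
    fun p => (fun x => p.1 (g x), fun c => prot_comp h g (p.2 c))
  else fun p => (fun x => p.1 (g x), fun y => p.2 (h y)).

Lemma cost_comp (X X' Y Y' : finType) (g : X -> X') (h : Y -> Y')
    (Ms : seq finType) (p : prot X' Y' Ms) x y l z :
  cost (prot_comp g h p) x y l z = cost p (g x) (h y) l z.
Proof.
elim: Ms X X' Y Y' g h p x y z => [|M Ms IH] X X' Y Y' g h p x y z //=.
Qed.

Section Game.
Variables (R : realType) (m n0 : nat).
Notation core := (core R m n0).
Notation bsize := (bsize R m n0).
Notation nblocks := (nblocks R m n0).
Notation base_case := (base_case R m n0).
Notation low_card := (low_card R m n0).
Notation own := (own R m n0).
Notation Drec := (Drec R m n0).
Notation shift_owner := (shift_owner R m n0).
Notation charged := (charged R m n0).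
Notation input f := (@input R m n0 f _).
Notation glue f := (@glue R m n0 f _).
Notation shell_prob := (@shell_prob R m n0).
Hypothesis core_le : forall n, (core n <= n)%N.
Hypothesis node_ok : forall n, base_case n = false ->
  ((core n).*2 <= n)%N /\ (0 < bsize n)%N.
Hypothesis nblocks_gt0 : (0 < nblocks)%N.

(** The player [true] speaks first, so [charged] serves as the flag [z] of [cost]. *)
Definition game_error (f n : nat) (P : nat -> bool) (Ms : seq finType)
    (p : prot {set 'I_(n.*2)} {set 'I_(n.*2)} Ms) : R :=
  \sum_(A : {set 'I_(n.*2)}) Drec f A *
    (cost p (own f P true A) (own f P false A) (odd (median A))
       (charged f P A))%:R.

Lemma chargedC f n P (A : {set 'I_(n.*2)}) :
  charged f (fun i => ~~ P i) A = ~~ charged f P A.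
Proof. by rewrite /charged ownerC. Qed.

Lemma game_errorC f n P Ms (p : prot {set 'I_(n.*2)} {set 'I_(n.*2)} Ms) :
  game_error f (fun i => ~~ P i) p =
  \sum_(A : {set 'I_(n.*2)}) Drec f A *
    (cost p (own f P false A) (own f P true A) (odd (median A))
       (~~ charged f P A))%:R.
Proof. by apply: eq_bigr => A _; rewrite chargedC !ownC. Qed.

Lemma game_error_ge0 f n P Ms (p : prot _ _ Ms) : 0 <= @game_error f n P Ms p.
Proof. by apply: sumr_ge0 => A _; rewrite mulr_ge0 ?Drec_ge0 ?ler0n. Qed.

(** Exactly one player is charged on each [A]; [silent_error] is applied to both players and the
    bounds are added. *)
Lemma game_error_silent f n P (p : prot _ _ [::]) : ~~ odd n -> (0 < n)%N ->
  2^-1 <= @game_error f n P [::] p.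
Proof.
move=> on n1.
have hA := silent_error core_le node_ok nblocks_gt0 f P p.1 on n1.
have hB := silent_error core_le node_ok nblocks_gt0 f (fun i => ~~ P i) p.2 on n1.
have -> : @game_error f n P [::] p =
   \sum_(A : {set 'I_(n.*2)}) Drec f A *
     (charged f P A && (p.1 (own f P true A) != odd (median A)))%:R
  + \sum_(A : {set 'I_(n.*2)}) Drec f A * (charged f (fun i => ~~ P i) A &&
      (p.2 (own f (fun i => ~~ P i) true A) != odd (median A)))%:R.
  rewrite -big_split; apply: eq_bigr => A _ /=.
  rewrite -mulrDr chargedC ownC; congr (_ * _).
  by case: (charged f P A); rewrite /= ?addr0 ?add0r.
apply: le_trans (lerD hA hB).
rewrite -mulrDr -big_split /=.
rewrite (eq_bigr (fun A : {set 'I_(n.*2)} => Drec f A)).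
  by rewrite (sum_Drec node_ok nblocks_gt0) mulr1.
move=> A _; rewrite chargedC -mulrDr.
by case: (charged f P A); rewrite /= ?addr0 ?add0r mulr1.
Qed.

Section Node.
Variables (f n : nat) (P : nat -> bool) (eps tau : R).
Hypothesis nb : base_case n = false.
Hypothesis on : ~~ odd n.
Hypothesis tau0 : 0 < tau.
Hypothesis tau2 : tau <= 2^-1.
Hypothesis leak : forall (j : 'I_nblocks) (d : {set 'I_(n - core n)} -> R),
  (forall s, 0 <= d s <= 2) ->
  \sum_S shell_prob j S * d (S :&: share (n - core n) P true) <=
  \sum_S shell_prob 0 S * d (S :&: share (n - core n) P true) + eps.

Let Uin := {set 'I_((bsize n).*2)}.
Let Xout := {set 'I_(n.*2)}.
Let lam (j : 'I_nblocks) (A : Uin) : bool * bool :=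
  (odd (median A), charged f (shift_owner n j P) A).

Lemma game_elimination (M : finType) (g : Xout -> M)
    (C : M -> Xout -> Xout -> bool -> bool -> bool) (val : 'I_nblocks -> R) :
  (forall j s r (sigma : Uin -> M) (phi : Uin -> M -> {ffun 'I_nblocks -> Uin})
      (chi : Uin -> {ffun 'I_nblocks -> Uin}),
    val j <= \sum_w Drec f w *
      (C (sigma (input f P false j w))
        (glue f P true s (phi (input f P true j w) (sigma (input f P false j w))))
        (glue f P false r (chi (input f P false j w)))
        (odd (median w)) (charged f (shift_owner n j P) w))%:R) ->
  nblocks%:R^-1 * (\sum_j val j) -
     (ln (#|M|%:R) / (nblocks%:R * tau) + 2 * tau + eps) <=
  \sum_(A : Xout) Drec f.+1 A * (C (g (own f.+1 P true A)) (own f.+1 P true A)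
     (own f.+1 P false A) (odd (median A)) (charged f.+1 P A))%:R.
Proof.
move=> valP.
rewrite (@sum_Drec_game R m n0 core_le node_ok nblocks_gt0 f n P
  (fun x y l z => (C (g x) x y l z)%:R) nb on).
pose C' c (s : {set 'I_(n - core n)}) x (r : {set 'I_(n - core n)}) y (l : bool * bool) : R :=
  (C c (glue f P true s x) (glue f P false r y) l.1 l.2)%:R.
apply: (@elimination R nblocks Uin Uin Uin (bool * bool)%type M {set 'I_(n - core n)}
  (@Defs.Drec R m n0 f (bsize n)) (input f P true) (input f P false) set0
  (@Drec_ge0 R m n0 f (bsize n)) (sum_Drec node_ok nblocks_gt0 f (bsize n))
  (fun s x => g (glue f P true s x)) {set 'I_(n - core n)} {set 'I_(n - core n)}
  lam C' _ _ (fun j => shell_prob j) (shell_prob 0)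
  (fun S => S :&: share (n - core n) P true)
  (fun S => S :&: share (n - core n) P false) eps tau val) => //.
- by move=> c s x r y l; rewrite /C' /= lern1 leq_b1.
- by move=> *; apply: shell_prob_ge0.
- by move=> j; apply: sum_shell_prob.
- by move=> *; apply: shell_prob_ge0.
- exact: sum_shell_prob.
Qed.

(** In the embedded game the other player opens, hence the complemented owner. The opening message
    is the pair of the simulated first message and the reply to it. *)
Lemma game_error_step (M M2 : finType) (Ms : seq finType) (val : 'I_nblocks -> R) :
  (forall j (p : prot Uin Uin (((M * M2)%type : finType) :: Ms)),
     val j <= game_error f (fun i => ~~ shift_owner n j P i) p) ->
  forall p : prot Xout Xout (M :: M2 :: Ms),
  nblocks%:R^-1 * (\sum_j val j) -
     (ln (#|M|%:R) / (nblocks%:R * tau) + 2 * tau + eps) <=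
  game_error f.+1 P p.
Proof.
move=> valP p; refine (@game_elimination M p.1
  (fun c x y l z => @cost Xout Xout (M2 :: Ms) (p.2 c) y x l (~~ z)) val _).
move=> j s r sigma phi chi.
pose gx c x := glue f P true s (phi x c).
pose gy y := glue f P false r (chi y).
have := valP j (fun y => (sigma y, (p.2 (sigma y)).1 (gy y)),
  fun cc => @prot_comp _ _ _ _ (gx cc.1) gy Ms ((p.2 cc.1).2 cc.2)).
rewrite game_errorC; congr (_ <= _); apply: eq_bigr => A _.
by rewrite /= cost_comp.
Qed.

(** Here no reply is left to carry the simulated message. If the speaker is charged, her answer is a
    function of her input alone and [silent_error] applies without loss. If the listener is charged,
    he alone needs the message, and after elimination he answers the embedded instance in
    silence. *)
Lemma game_error_last (M : finType) (p : prot Xout Xout [:: M]) : (0 < n)%N ->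
  2^-1 - (ln (#|M|%:R) / (nblocks%:R * tau) + 2 * tau + eps) <=
  game_error f.+1 P p.
Proof.
move=> n1; have [_ bs0] := node_ok nb.
pose a x := (p.2 (p.1 x)).2 x.
have hA := silent_error core_le node_ok nblocks_gt0 f.+1 P a on n1.
pose val j : R := 2^-1 * \sum_(A : Uin)
  Drec f A * (charged f (fun i => ~~ shift_owner n j P i) A)%:R.
have hB := @game_elimination M p.1 (fun c x y l z => ~~ z && ((p.2 c).1 y != l)) val.
have {}hB := hB _.
have -> : game_error f.+1 P p =
   \sum_(A : Xout) Drec f.+1 A * (charged f.+1 P A && (a (own f.+1 P true A) != odd (median A)))%:R
  + \sum_(A : Xout) Drec f.+1 A * (~~ charged f.+1 P A &&
      ((p.2 (p.1 (own f.+1 P true A))).1 (own f.+1 P false A) != odd (median A)))%:R.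
  rewrite -big_split; apply: eq_bigr => A _ /=.
  rewrite -mulrDr; congr (_ * _).
  by case: (charged f.+1 P A); rewrite /= ?addr0 ?add0r.
apply: le_trans (lerD hA (hB _)); last first.
  move=> j s r sigma phi chi.
  apply: le_trans (silent_error core_le node_ok nblocks_gt0 f
    (fun i => ~~ shift_owner n j P i)
    (fun y => (p.2 (sigma y)).1 (glue f P false r (chi y))) _ bs0) _.
    by rewrite odd_double.
  by rewrite le_eqVlt; apply/orP; left; apply/eqP; apply: eq_bigr => A _; rewrite chargedC ownC.
rewrite addrA lerD2r.
rewrite (@sum_Drec_game R m n0 core_le node_ok nblocks_gt0 f n P
  (fun _ _ _ z => z%:R) nb on).
have zE (j : 'I_nblocks) : \sum_(S : {set 'I_(n - core n)}) shell_prob j S *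
    EE (@Defs.Drec R m n0 f (bsize n)) (fun T =>
      (charged f (shift_owner n j P) (T j))%:R) =
    \sum_(A : Uin) Drec f A * (charged f (shift_owner n j P) A)%:R.
  rewrite -[LHS]mulr_suml [X in X * _](_ : _ = 1) ?mul1r; last first.
    exact: (sum_shell_prob node_ok nblocks_gt0 j nb).
  exact: (@sum_prod_coord R _ _ (fun=> @Defs.Drec R m n0 f (bsize n)) j
    (fun A => (charged f (shift_owner n j P) A)%:R)
    (fun=> sum_Drec node_ok nblocks_gt0 f (bsize n))).
under eq_bigr do rewrite zE.
rewrite -mulr_sumr [2^-1 * (_ * _)]mulrCA -mulrDr -mulrDr -big_split /=.
rewrite (eq_bigr (fun=> 1)).
  rewrite sumr_const card_ord mulrCA mulVf ?mulr1 // pnatr_eq0.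
  by rewrite -lt0n.
move=> j _; rewrite -big_split /=.
rewrite -[RHS](sum_Drec node_ok nblocks_gt0 f (bsize n)).
apply: eq_bigr => A _; rewrite chargedC -mulrDr.
by case: (charged f _ A); rewrite /= ?addr0 ?add0r mulr1.
Qed.

End Node.
End Game.

(** * The induction over rounds *)

Lemma card_shareC N P pl : #|share N (fun i => ~~ P i) pl| = (N - #|share N P pl|)%N.
Proof.
have -> : share N (fun i => ~~ P i) pl = ~: share N P pl.
  by apply/setP => i; rewrite !inE; case: (P i); case: pl.
by have := cardsC (share N P pl); rewrite card_ord; lia.
Qed.

Lemma unbalancedC N P : unbalanced N (fun i => ~~ P i) = unbalanced N P.
Proof.
rewrite /unbalanced card_shareC.
have : (#|share N P true| <= N)%N by rewrite -[leqRHS]card_ord max_card.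
lia.
Qed.

Section Induction.
Variables (R : realType) (m n0 : nat).
Notation core := (core R m n0).
Notation bsize := (bsize R m n0).
Notation nblocks := (nblocks R m n0).
Notation base_case := (base_case R m n0).
Notation low_card := (low_card R m n0).
Notation shift_owner := (shift_owner R m n0).
Notation shell_prob := (@shell_prob R m n0 _).
Notation game_error := (@game_error R m n0).

(** * What one part of the shell reveals about the index of the block *)

Section Leak.
Variables (n : nat) (P : nat -> bool) (L : R).
Hypothesis on : ~~ odd n.
Hypothesis n_gt0 : (0 < n)%N.
Hypothesis L0 : 0 < L.
Hypothesis core16 : (16 * core n <= n)%N.
Hypothesis coreL : (core n)%:R * L <= Num.sqrt n%:R.
Hypothesis bal : unbalanced n P = false.

Let N := (n - core n)%N.
Let Q := share N P true.

Let cardQ : (4 * #|Q| <= 3 * n)%N.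
Proof.
move: bal => /negbFE /andP[_ h]; apply: leq_trans h; rewrite leq_mul2l /=.
have wN : (N <= n)%N by apply: leq_subr.
rewrite -(card_imset Q (f := widen_ord wN)); last first.
  by move=> i j /(congr1 val) /= /val_inj.
by apply/subset_leq_card/subsetP => x /imsetP[i iQ ->]; move: iQ; rewrite !inE.
Qed.

Lemma sum_shell_trace (j : nat) (d : {set 'I_N} -> R) :
  \sum_S shell_prob j S * d (S :&: Q) = trace_mean Q (low_card n j) d.
Proof.
rewrite /trace_mean [RHS]big_mkcond; apply: eq_bigr => S _.
by rewrite /shell_prob card_ord; case: eqP; rewrite ?mul1r ?mul0r.
Qed.

Let step (i : nat) (d : {set 'I_N} -> R) : (forall s, 0 <= d s <= 2) ->
  (n <= 4 * i.+1)%N -> (2 * i < n)%N ->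
  trace_mean Q i d <= trace_mean Q i.+1 d + 1024 / Num.sqrt n%:R.
Proof.
move=> d2 i1 i2.
have nR : 0 < n%:R :> R by rewrite ltr0n.
have sn : 0 < Num.sqrt n%:R :> R by rewrite sqrtr_gt0.
have sq : Num.sqrt n%:R ^+ 2 = n%:R :> R by rewrite sqr_sqrtr ?ltW.
have NE : (N + core n = n)%N by rewrite /N subnK //; lia.
have cQ := cardQ.
have Nn : (N.+1 <= 2 * n)%N by lia.
have Qn : (#|Q| <= n)%N by lia.
have iN : (i < N)%N by lia.
have h1 : (n <= 8 * (N - #|Q|).+1)%N by lia.
have h2 : (n <= 4 * (N - i))%N by lia.
(* [B^2 = 4 n^3] bounds the scaled variance. With the denominators at least [n/4], [n/8] and [n/4],
   and [N + 1 <= 2 n], the constant becomes [8 * 128 = 1024]. *)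
set B := 2 * n%:R * Num.sqrt n%:R : R.
have B0 : 0 < B by rewrite !mulr_gt0.
have hB : #|Q|%:R * i.+1%:R * #|'I_N|.+1%:R <= B ^+ 2.
  rewrite card_ord /B exprMn sq.
  have -> : (2 * n%:R) ^+ 2 * n%:R = n%:R * (2 * n)%:R * (2 * n)%:R :> R.
    by rewrite natrM; ring.
  by rewrite -!natrM ler_nat; apply: leq_mul => //; apply: leq_mul; lia.
apply: le_trans (trace_mean_step (B := B) d2 _ B0 hB) _; first by rewrite card_ord.
rewrite lerD2l card_ord.
have b1 : n%:R <= 4 * i.+1%:R :> R by rewrite -natrM ler_nat.
have b2 : n%:R <= 8 * (N - #|Q|).+1%:R :> R by rewrite -natrM ler_nat.
have b3 : n%:R <= 4 * (N - i)%:R :> R by rewrite -natrM ler_nat.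
have b4 : N.+1%:R <= 2 * n%:R :> R by rewrite -natrM ler_nat.
move: b1 b2 b3 b4; set x := i.+1%:R; set y := (_ - _).+1%:R; set z := (N - i)%:R.
set w := N.+1%:R => b1 b2 b3 b4.
have [x0 y0 z0] : [/\ 0 < x, 0 < y & 0 < z] by split; lra.
rewrite mulrA ler_pdivrMr ?mulr_gt0 // [leRHS]mulrAC ler_pdivlMr //.
have -> : 2 * (B * w) * Num.sqrt n%:R = 4 * n%:R ^+ 2 * w.
  transitivity (4 * n%:R * w * Num.sqrt n%:R ^+ 2); first by rewrite /B; ring.
  by rewrite sq; ring.
have p1 : n%:R * n%:R <= (4 * x) * (8 * y) by apply: ler_pM => //; apply: ltW.
have p2 : n%:R * n%:R * n%:R <= (4 * x) * (8 * y) * (4 * z).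
  by apply: ler_pM => //; rewrite ?mulr_ge0 // ltW.
have : 4 * n%:R ^+ 2 * w <= 4 * n%:R ^+ 2 * (2 * n%:R).
  by rewrite ler_wpM2l // mulr_ge0 ?sqr_ge0.
lra.
Qed.

(** Passing from [low_card n j] to [low_card n 0] takes [j * bsize n <= core n] unit steps, each
    costing [1024 / sqrt n], and [core n] is at most [sqrt n / L]. *)
Lemma shell_leak (j : 'I_nblocks) (d : {set 'I_N} -> R) :
  (forall s, 0 <= d s <= 2) ->
  \sum_S shell_prob j S * d (S :&: Q) <=
  \sum_S shell_prob 0 S * d (S :&: Q) + 1024 / L.
Proof.
move=> d2; rewrite !sum_shell_trace.
have cE : core n = (nblocks * bsize n)%N by [].
have jc : (j * bsize n + bsize n <= core n)%N.
  by rewrite cE -mulSnr leq_mul2r ltn_ord orbT.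
have ob : ~~ odd (bsize n) by rewrite odd_double.
have -> : low_card n 0 = (low_card n j + j * bsize n)%N.
  by rewrite /low_card mul0n add0n; lia.
have sn : 0 < Num.sqrt n%:R :> R by rewrite sqrtr_gt0 ltr0n.
apply: le_trans (trace_mean_steps (d := j * bsize n) (eta := 1024 / Num.sqrt n%:R) _) _.
  move=> i /andP[i1 i2]; apply: step => //; move: i1 i2; rewrite /low_card; lia.
rewrite lerD2l ler_pdivlMr //.
rewrite [leLHS](_ : _ = 1024 * ((j * bsize n)%:R * L) / Num.sqrt n%:R); last by ring.
rewrite ler_pdivrMr // ler_wpM2l // (le_trans _ coreL) // ler_wpM2r ?(ltW L0) //.
by rewrite ler_nat; lia.
Qed.

End Leak.

(** For a fixed partition, the expected number of unbalanced instances among the first [s] on a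
    random path down the recursion. *)
Fixpoint imbalance (s n : nat) (P : nat -> bool) : R :=
  if s is s'.+1 then (unbalanced n P)%:R +
    nblocks%:R^-1 * \sum_(j < nblocks) imbalance s' (bsize n) (shift_owner n j P)
  else 0.

Lemma imbalance_ge0 s n P : 0 <= imbalance s n P.
Proof.
elim: s n P => [|s IH] n P //=.
by rewrite addr_ge0 ?ler0n // mulr_ge0 ?invr_ge0 ?ler0n // sumr_ge0.
Qed.

Lemma imbalanceC s n P : imbalance s n (fun i => ~~ P i) = imbalance s n P.
Proof.
elim: s n P => [|s IH] n P //=; rewrite unbalancedC; congr (_ + _ * _).
by apply: eq_bigr => j _; apply: (IH _ (shift_owner n j P)).
Qed.

Variables (good : nat -> nat -> Prop) (L tau : R) (B : finType) (t : nat).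
Hypothesis core_le : forall n, (core n <= n)%N.
Hypothesis node_ok : forall n, base_case n = false ->
  ((core n).*2 <= n)%N /\ (0 < bsize n)%N.
Hypothesis nblocks_gt0 : (0 < nblocks)%N.
Hypothesis L0 : 0 < L.
Hypothesis tau0 : 0 < tau.
Hypothesis tau2 : tau <= 2^-1.
Hypothesis good_node : forall s n, good s.+1 n ->
  [/\ (0 < n)%N, base_case n = false, (16 * core n <= n)%N &
      (core n)%:R * L <= Num.sqrt n%:R].
Hypothesis good_next : forall s n, good s.+2 n -> good s.+1 (bsize n).

(** The factor [t] allows for the growth of the first message, which may come to consist of up to
    [t] original ones. *)
Definition round_loss : R :=
  t%:R * ln (#|B|%:R) / (nblocks%:R * tau) + 2 * tau + 1024 / L.

Hypothesis B0 : (0 < #|B|)%N.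

Let lnB0 : 0 <= ln (#|B|%:R : R). Proof. by rewrite ln_ge0 // ler1n. Qed.

Lemma ln_card_le (M : finType) r : (#|M| <= #|B| ^ r)%N -> (r <= t)%N ->
  ln (#|M|%:R : R) <= t%:R * ln (#|B|%:R).
Proof.
move=> Mr rt; have [M0|M0] := posnP #|M|.
  by rewrite M0 ln0 // mulr_ge0 ?ler0n.
apply: (@le_trans _ _ (ln ((#|B| ^ r)%:R))).
  by rewrite ler_ln ?posrE ?ltr0n ?ler_nat // expn_gt0 B0.
rewrite natrX lnXn ?ltr0n // -[_ *+ _]mulr_natl.
by rewrite ler_wpM2r // ler_nat.
Qed.

Lemma loss_le (M : finType) r : (#|M| <= #|B| ^ r)%N -> (r <= t)%N ->
  ln (#|M|%:R) / (nblocks%:R * tau) + 2 * tau + 1024 / L <= round_loss.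
Proof.
move=> Mr rt; rewrite /round_loss !lerD2r ler_wpM2r ?(ln_card_le Mr rt) //.
by rewrite invr_ge0 mulr_ge0 ?ler0n ?ltW.
Qed.

Lemma round_loss_ge0 : 0 <= round_loss.
Proof.
have [t0 l0] := (ltW tau0, ltW L0).
by rewrite /round_loss !addr_ge0 // ?divr_ge0 ?mulr_ge0 ?ler0n.
Qed.

(** [r] counts the original messages merged into the first one; an elimination raises [r] and lowers
    [s], so [r + s] is invariant. On an unbalanced instance [imbalance] is at least one, the bound
    is negative and nothing is to be proved. *)
Lemma game_error_ge s f n P (M : finType) r :
  good s.+1 n -> (n <= f)%N -> ~~ odd n ->
  (#|M| <= #|B| ^ r)%N -> (r + s <= t)%N ->
  forall p : prot {set 'I_(n.*2)} {set 'I_(n.*2)} (M :: nseq s B),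
  2^-1 - s.+1%:R * round_loss - imbalance s.+1 n P <= game_error f P p.
Proof.
elim: s f n P M r => [|s IH] f n P M r g nf on Mr rst p;
  have [n1 nb c16 cL] := good_node g;
  (have [ub|/negbTE bal] := boolP (unbalanced n P);
   [apply: (@le_trans _ _ 0); [|exact: game_error_ge0] |
    case: f nf p => [|f] nf p; first by [move: n1; rewrite ltnNge nf]]).
- rewrite [imbalance _ _ _]/= ub big1 // mulr0 addr0 mulr1n.
  by have := round_loss_ge0; lra.
- have lk := shell_leak on n1 L0 c16 cL bal.
  have H := game_error_last core_le node_ok nblocks_gt0 f nb on tau0 tau2 lk p n1.
  apply: le_trans H.
  have := loss_le Mr (leq_trans (leq_addr _ _) rst).
  by have := imbalance_ge0 1 n P; lra.
- rewrite [imbalance _ _ _]/= ub.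
  have := mulr_ge0 (ler0n R s.+2) round_loss_ge0.
  have : 0 <= nblocks%:R^-1 * \sum_(j < nblocks) imbalance s.+1 (bsize n) (shift_owner n j P).
    by rewrite mulr_ge0 ?invr_ge0 ?ler0n // sumr_ge0 // => j _; apply: imbalance_ge0.
  by rewrite /= mulr1n; lra.
have lk := shell_leak on n1 L0 c16 cL bal.
have bsn : (bsize n <= f)%N.
  have : (bsize n <= core n)%N by rewrite /core leq_pmull.
  lia.
pose val (j : 'I_nblocks) := 2^-1 - s.+1%:R * round_loss -
  imbalance s.+1 (bsize n) (shift_owner n j P).
apply: le_trans (game_error_step core_le node_ok nblocks_gt0 nb on tau0 tau2
  lk (f := f) (val := val) _ p); last first.
  move=> j p'; rewrite /val -imbalanceC; apply: (IH _ _ _ _ r.+1) => //.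
  - exact: good_next.
  - by rewrite odd_double.
  - by rewrite card_prod expnSr leq_mul2r Mr orbT.
  by rewrite addSnnS.
have k0 : 0 < nblocks%:R :> R by rewrite ltr0n.
have -> : nblocks%:R^-1 * \sum_j val j = 2^-1 - s.+1%:R * round_loss -
   nblocks%:R^-1 * \sum_(j < nblocks) imbalance s.+1 (bsize n) (shift_owner n j P).
  rewrite /val sumrB mulrBr sumr_const card_ord -[(_ - _) *+ nblocks]mulr_natl mulKf //.
  by rewrite gt_eqF.
have := loss_le Mr (leq_trans (leq_addr _ _) rst).
rewrite [imbalance s.+2 _ _]/= -/(imbalance s.+1).
have : 0 <= (unbalanced n P)%:R :> R by rewrite ler0n.
rewrite -[s.+2%:R]natr1.
set X := nblocks%:R^-1 * _; lra.
Qed.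

End Induction.

(** * Random partitions and transcripts *)

Definition set_owner (n : nat) (P : {set 'I_n}) (i : nat) : bool :=
  [exists j : 'I_n, (j \in P) && (j == i :> nat)].

Lemma set_ownerE n (P : {set 'I_n}) (i : 'I_n) : set_owner P i = (i \in P).
Proof.
apply/existsP/idP => [[j /andP[jP /eqP /val_inj <-]] //|iP].
by exists i; rewrite iP eqxx.
Qed.

Section Average.
Variables (R : realType) (m n0 n : nat).
Notation core := (core R m n0).
Notation bsize := (bsize R m n0).
Notation nblocks := (nblocks R m n0).
Hypothesis n_even : n = (n./2).*2.
Hypothesis core_le : forall n, (core n <= n)%N.
Hypothesis nblocks_gt0 : (0 < nblocks)%N.
Variables (good : nat -> nat -> Prop) (L : R).
Hypothesis L0 : 0 < L.
Hypothesis good_next : forall s n, good s.+2 n -> good s.+1 (bsize n).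
Hypothesis good_large : forall s n, good s.+1 n -> (0 < n)%N /\ L <= n%:R.

Definition half_mean (F : {set 'I_n} -> R) : R :=
  \sum_(P : {set 'I_n} | #|P| == n./2) 'C(n, n./2)%:R^-1 * F P.

Lemma half_mean_unbalanced N (iota : nat -> nat) : (0 < N)%N -> L <= N%:R ->
  (forall i, (i < N)%N -> (iota i < n)%N) ->
  (forall i j, (i < N)%N -> (j < N)%N -> iota i = iota j -> i = j) ->
  half_mean (fun P => (unbalanced N (fun i => set_owner P (iota i)))%:R) <= 8 / L.
Proof.
move=> N0 LN iN ii.
pose e (i : 'I_N) : 'I_n := Ordinal (iN i (ltn_ord i)).
have ei : injective e.
  by move=> i j /(congr1 val) /= h; apply: val_inj; apply: (ii i j).
pose B := [set e i | i : 'I_N].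
have cB : #|B| = N by rewrite card_imset // card_ord.
have shE (P : {set 'I_n}) :
    #|share N (fun i => set_owner P (iota i)) true| = #|P :&: B|.
  rewrite -(card_imset _ ei); apply: eq_card => x; rewrite inE.
  apply/imsetP/andP => [[i]|[xP /imsetP[i _ xE]]].
    rewrite inE => /eqP iP ->; split; last by apply/imsetP; exists i.
    by rewrite -(set_ownerE P (e i)).
  by exists i => //; rewrite inE -[iota i]/(nat_of_ord (e i)) set_ownerE -xE xP.
have := @unbalanced_rare R 'I_n B n./2; rewrite card_ord cB => /(_ n_even N0) h.
apply: le_trans (_ : 8 / N%:R <= _).
  by apply: le_trans h; apply: ler_sum => P _; rewrite /unbalanced shE.
by rewrite ler_wpM2l // lef_pV2 // posrE ltr0n.
Qed.

Lemma half_mean_const c : half_mean (fun=> c) = c.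
Proof.
rewrite /half_mean -big_distrl /= sumr_const.
have -> : #|[pred P : {set 'I_n} | #|P| == n./2]| = 'C(n, n./2).
  rewrite -[in RHS](card_ord n) -card_draws; apply: eq_card => P.
  by rewrite [RHS]inE card_ord.
rewrite -[_ *+ _]mulr_natr mulVf ?mul1r // pnatr_eq0 -lt0n bin_gt0.
by rewrite [leqRHS]n_even -addnn leq_addr.
Qed.

(** Linearity of expectation: each level of the path contributes at most [8 / L]. *)
Lemma half_mean_imbalance s N (iota : nat -> nat) : (s = 0%N \/ good s N) ->
  (forall i, (i < N)%N -> (iota i < n)%N) ->
  (forall i j, (i < N)%N -> (j < N)%N -> iota i = iota j -> i = j) ->
  half_mean (fun P => imbalance R m n0 s N (fun i => set_owner P (iota i))) <=
  s%:R * (8 / L).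
Proof.
elim: s N iota => [|s IH] N iota g iN ii.
  by rewrite half_mean_const mul0r.
have {}g : good s.+1 N by case: g.
have [N0 NL] := good_large g.
have k0 : 0 < nblocks%:R :> R by rewrite ltr0n.
rewrite -natr1 mulrDl mul1r addrC.
rewrite /half_mean /=; under eq_bigr do rewrite mulrDr.
rewrite big_split /=; apply: lerD; first exact: half_mean_unbalanced.
have -> : \sum_(P : {set 'I_n} | #|P| == n./2) 'C(n, n./2)%:R^-1 * (nblocks%:R^-1 *
    \sum_(j < nblocks) imbalance R m n0 s (bsize N)
      (shift_owner R m n0 N j (fun i => set_owner P (iota i)))) =
  nblocks%:R^-1 * \sum_(j < nblocks) half_mean (fun P => imbalance R m n0 s (bsize N)
      (fun i => set_owner P (iota (N - core N + j * bsize N + i)%N))).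
  under eq_bigr do rewrite mulrCA mulr_sumr.
  by rewrite -mulr_sumr exchange_big.
rewrite mulrC ler_pdivrMr // mulrC.
have -> : nblocks%:R * (s%:R * (8 / L)) = \sum_(j < nblocks) (s%:R * (8 / L)) :> R.
  by rewrite sumr_const card_ord mulr_natl.
apply: ler_sum => j _.
have cN := core_le N.
have bnd i : (i < bsize N)%N -> (N - core N + j * bsize N + i < N)%N.
  move=> hi; have : (j * bsize N + i < core N)%N; last by lia.
  apply: (@leq_trans (j.+1 * bsize N)); last by rewrite leq_mul2r ltn_ord orbT.
  by rewrite mulSn addnC ltn_add2r.
apply: (IH (bsize N) (fun i => iota (N - core N + j * bsize N + i)%N)).
- by case: (s) g => [|s'] g; [left | right; apply: good_next].
- by move=> i /bnd /iN.
move=> i i' /bnd hi /bnd hi' /(ii _ _ hi hi'); lia.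
Qed.

End Average.

Section Translation.
Variables (n m : nat) (p : protocol n m) (P : {set 'I_n}).
Let X : finType := {set 'I_(n.*2)}.
Let B : finType := m.-bseq bool.

Fixpoint strategy (t : nat) (h : seq B) (pl : bool) : prot X X (nseq t B) :=
  if t is u.+1 return prot X X (nseq t B) then
    (fun x => message p pl P x h, fun c => strategy u (rcons h c) (~~ pl))
  else (fun x => answer p pl P x h, fun y => answer p (~~ pl) P y h).

(** An error of the charged player is an error of the protocol, whoever is charged. *)
Lemma cost_strategy (inp : bool -> X) t u l z :
  cost (strategy t (transcript p P inp u) (speaker p u))
    (inp (speaker p u)) (inp (~~ speaker p u)) l z ->
  ~~ [forall b, answer p b P (inp b) (transcript p P inp (u + t)) == l].
Proof.
elim: t u z => [|t IH] u z /=.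
  rewrite addn0 => h; apply/forallPn.
  by exists (if z then speaker p u else ~~ speaker p u); case: z h.
rewrite addnS -addSn => h; apply: (IH u.+1 (~~ z)).
by rewrite /speaker /= addbN negbK.
Qed.

End Translation.

Section Error.
Variables (R : realType) (m n0 n : nat).
Hypothesis core_le : forall n, (core R m n0 n <= n)%N.

Lemma owned_own (P : {set 'I_n}) pl A :
  owned R m n0 P pl A = own R m n0 n (set_owner P) pl A.
Proof.
apply/setP => x; rewrite !inE; congr (_ && _).
have := @pairing_owner R m n0 core_le n n (set_owner P) pl x.
rewrite ltn_ord /= => <-; apply: eq_existsb => i.
by rewrite set_ownerE.
Qed.

(** In the game the player [true] opens; if Bob opens the protocol, the players are exchanged by
    complementing the owner. *)
Lemma protocol_error_ge (p : protocol n m) (t : nat) (P : {set 'I_n}) v :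
  (forall Q (q : prot _ _ (nseq t (m.-bseq bool : finType))),
     (Q = set_owner P \/ Q = (fun i => ~~ set_owner P i)) ->
     v <= @game_error R m n0 n n Q _ q) ->
  v <= \sum_(A : {set 'I_(n.*2)}) D R m n0 A * (~~ correct R n0 p t P A)%:R.
Proof.
move=> H; pose q := strategy p P t [::] (first p).
have wrong A z : cost q (owned R m n0 P (first p) A) (owned R m n0 P (~~ first p) A)
    (odd (median A)) z -> ~~ correct R n0 p t P A.
  have := @cost_strategy n m p P (fun pl => owned R m n0 P pl A) t 0
    (odd (median A)) z.
  by rewrite /speaker /= addbF.
have le_wrong A (b : bool) : (b -> ~~ correct R n0 p t P A) ->
    D R m n0 A * b%:R <= D R m n0 A * (~~ correct R n0 p t P A)%:R.
  move=> h; apply: ler_wpM2l; first exact: Drec_ge0.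
  by rewrite ler_nat; case: b h => // ->.
case fp : (first p).
  apply: le_trans (H _ q (or_introl erefl)) _; apply: ler_sum => A _.
  apply: le_wrong; rewrite -!owned_own => h.
  by apply: (wrong A _); rewrite fp; apply: h.
apply: le_trans (H _ q (or_intror erefl)) _; rewrite game_errorC.
apply: ler_sum => A _.
apply: le_wrong; rewrite -!owned_own => h.
by apply: (wrong A _); rewrite fp; apply: h.
Qed.

End Error.

(** * Size of the recursive instances *)

Lemma cube_le_exp t : (t ^ 3 <= 8 * 2 ^ t)%N.
Proof.
case: (ltnP t 4) => [|t4]; first by case: t => [|[|[|[|]]]].
rewrite -(subnK t4); elim: (t - 4)%N => [//|k IH]; rewrite addSn (expnS 2) mulnCA.
apply: leq_trans _ (leq_mul (leqnn 2) IH); rewrite !expnS expn0 !muln1; nia.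
Qed.

Lemma le_of_16 c n : (16 * c <= n)%N -> (c <= n)%N /\ (c.*2 <= n)%N.
Proof. lia. Qed.

Lemma exponents_ge s : (2 <= 2 ^ s.+2 - 2)%N /\ (10 <= 9 * 2 ^ s.+1 - 8)%N.
Proof. have s1 : (0 < 2 ^ s)%N by rewrite expn_gt0. rewrite !expnS; lia. Qed.

Lemma exponents_double s : (2 ^ s.+3 - 2 = (2 ^ s.+2 - 2) * 2 + 2)%N /\
  (9 * 2 ^ s.+2 - 8 = (9 * 2 ^ s.+1 - 8) * 2 + 8)%N.
Proof. have s1 : (0 < 2 ^ s)%N by rewrite expn_gt0. rewrite !expnS; lia. Qed.

Section Numerics.
Variables (R : realType) (m n0 t : nat).
Notation core := (core R m n0).
Notation bsize := (bsize R m n0).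
Notation nblocks := (nblocks R m n0).
Notation base_case := (base_case R m n0).
Variable L : R.
Hypothesis LE : log2 (n0%:R : R) = L.
Hypothesis L16 : 16 <= L.
Hypothesis Lm : L <= m%:R.
Hypothesis tL : (2 ^ t)%:R <= L.

Let L0 : 0 < L. Proof. by apply: lt_le_trans L16. Qed.
Let L1 : 1 <= L. Proof. by apply: le_trans L16; rewrite ler1n. Qed.
Let m1 : 1 <= m%:R :> R. Proof. exact: le_trans Lm. Qed.
Let L2 : 256 <= L ^+ 2. Proof. by have := L16; nra. Qed.
Let mL : 256 <= m%:R * L ^+ 2. Proof. by have := m1; have := L2; nra. Qed.

Lemma nblocks_le : nblocks%:R <= m%:R * L ^+ 2.
Proof. by rewrite /Defs.nblocks LE truncn_le; apply: le_trans mL. Qed.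

Lemma nblocks_ge : m%:R * L ^+ 2 / 2 <= nblocks%:R.
Proof.
have h : m%:R * L ^+ 2 < nblocks.+1%:R by rewrite /Defs.nblocks LE truncnS_gt.
by rewrite -natr1 in h; have := mL; lra.
Qed.

Lemma nblocks_pos : (0 < nblocks)%N.
Proof. by rewrite -(ltr0n R); apply: lt_le_trans nblocks_ge; have := mL; lra. Qed.

Let k0 : 0 < nblocks%:R :> R. Proof. by rewrite ltr0n nblocks_pos. Qed.

(** [2 * x n] is the number of pairs of a block before rounding. *)
Let x (n : nat) : R := Num.sqrt n%:R / L ^+ 2 / (2 * nblocks%:R).

Let x0 n : 0 <= x n.
Proof.
apply: divr_ge0; last by rewrite mulr_ge0 // ltW.
by apply: divr_ge0; [apply: sqrtr_ge0 | apply: sqr_ge0].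
Qed.

Let xE n : nblocks%:R * (2 * x n) * L ^+ 2 = Num.sqrt n%:R.
Proof. by rewrite /x; field; rewrite !gt_eqF. Qed.

Let bsizeE n : (bsize n)%:R = 2 * (Num.truncn (x n))%:R :> R.
Proof. by rewrite -natrM mul2n /Defs.bsize LE. Qed.

Lemma core_bound n : (core n)%:R * L ^+ 2 <= Num.sqrt n%:R.
Proof.
rewrite -xE /core natrM bsizeE; apply: ler_wpM2r; first exact: sqr_ge0.
by apply: ler_wpM2l; [exact: ltW | apply: ler_wpM2l => //; rewrite truncn_le].
Qed.

Lemma sqrt_nat_le (n : nat) : Num.sqrt n%:R <= n%:R :> R.
Proof.
case: n => [|n]; first by rewrite sqrtr0.
rewrite -[leRHS]ger0_norm ?ler0n // -sqrtr_sqr ler_sqrt ?sqr_ge0 //.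
by rewrite expr2 -natrM ler_nat leq_pmulr.
Qed.

Lemma core_small n : (16 * core n <= n)%N.
Proof.
rewrite -(ler_nat R) natrM; apply: le_trans (sqrt_nat_le n).
apply: le_trans (core_bound n); rewrite mulrC ler_wpM2l ?ler0n //.
by have := L2; lra.
Qed.

Lemma core_le n : (core n <= n)%N.
Proof. by case: (le_of_16 (core_small n)). Qed.

Lemma core_sqrt n : (core n)%:R * L <= Num.sqrt n%:R.
Proof.
apply: le_trans (core_bound n); rewrite ler_wpM2l ?ler0n // expr2.
by rewrite ler_peMr // ltW.
Qed.

Lemma node_ok n : base_case n = false ->
  ((core n).*2 <= n)%N /\ (0 < bsize n)%N.
Proof.
move=> /negbT; rewrite /Defs.base_case LE -leNgt => nb.
split; first by case: (le_of_16 (core_small n)).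
rewrite double_gt0 LE truncn_gt0 -/(x n).
have := nb; rewrite -xE => h.
have h2 : nblocks%:R * (2 * x n) * L ^+ 2 = nblocks%:R * L ^+ 2 * (2 * x n) by ring.
have h3 : nblocks%:R * L ^+ 3 = nblocks%:R * L ^+ 2 * L by ring.
move: h; rewrite h2 h3 ler_pM2l ?mulr_gt0 ?exprn_gt0 // => h.
by have := L16; lra.
Qed.

(** The solution of [weight s.+1 = (weight s * m * L^4)^2] with [weight 0 = L]: an embedded instance
    has about [sqrt n / (m L^4)] pairs. *)
Definition weight (s : nat) : R :=
  m%:R ^+ (2 ^ s.+1 - 2) * L ^+ (9 * 2 ^ s - 8).

(* The slack [4 ^+ s / L ^+ 2] pays for the rounding of the block sizes: taking
   a square root halves a slack, of which a quarter is kept. *)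
Definition good (s n : nat) : Prop :=
  (s <= t)%N /\ (1 + 4 ^+ s / L ^+ 2) * weight s <= n%:R.

Let slack_ge0 s : 0 <= 4 ^+ s / L ^+ 2.
Proof. by rewrite divr_ge0 ?exprn_ge0 ?(ltW L0). Qed.

Lemma slack_le1 s : (s <= t)%N -> 4 ^+ s / L ^+ 2 <= 1.
Proof.
move=> st; rewrite ler_pdivrMr ?exprn_gt0 // mul1r.
apply: le_trans (_ : ((2 ^ t)%:R) ^+ 2 <= _); last first.
  by apply: lerXn2r; rewrite ?nnegrE ?ler0n ?(ltW L0).
rewrite -natrX -natrX ler_nat -expnM mulnC expnM.
by rewrite leq_pexp2l.
Qed.

(** The left side is the square of [m L^2 * L^3], an upper bound for the threshold of the base
    case. *)
Lemma weight_ge s : m%:R ^+ 2 * L ^+ 10 <= weight s.+1.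
Proof.
have [e1 e2] := exponents_ge s.
rewrite /weight; apply: ler_pM; rewrite ?exprn_ge0 ?ler0n ?(ltW L0) //.
  exact: ler_weXn2l.
exact: ler_weXn2l.
Qed.

Lemma good_weight s n : good s.+1 n -> m%:R ^+ 2 * L ^+ 10 <= n%:R.
Proof.
case=> _ h; apply: le_trans (weight_ge s) _; apply: le_trans h.
rewrite ler_peMl ?lerDl ?slack_ge0 //.
by rewrite mulr_ge0 ?exprn_ge0 ?ler0n ?(ltW L0).
Qed.

Lemma good_large s n : good s.+1 n -> (0 < n)%N /\ L <= n%:R.
Proof.
move=> /good_weight h; have hL : L <= n%:R.
  apply: le_trans h; apply: le_trans (_ : 1 * L ^+ 10 <= _).
    by rewrite mul1r -[leLHS]expr1; apply: ler_weXn2l.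
  by rewrite ler_wpM2r ?exprn_ge0 ?(ltW L0) // exprn_ege1.
by split => //; rewrite -(ltr0n R); apply: lt_le_trans hL.
Qed.

Lemma good_node s n : good s.+1 n ->
  [/\ (0 < n)%N, base_case n = false, (16 * core n <= n)%N &
      (core n)%:R * L <= Num.sqrt n%:R].
Proof.
move=> g; have [n1 _] := good_large g.
split=> //; [|exact: core_small|exact: core_sqrt].
apply/negbTE; rewrite /Defs.base_case LE -leNgt.
apply: (@le_trans _ _ (Num.sqrt (m%:R ^+ 2 * L ^+ 10))); last first.
  by rewrite ler_sqrt ?ler0n ?(good_weight g).
have -> : m%:R ^+ 2 * L ^+ 10 = (m%:R * L ^+ 2 * L ^+ 3) ^+ 2 by ring.
have L3 : 0 <= L ^+ 3 by apply/exprn_ge0/ltW.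
rewrite sqrtr_sqr ger0_norm; first by rewrite ler_wpM2r ?nblocks_le.
by apply: mulr_ge0 => //; apply: mulr_ge0 => //; apply: sqr_ge0.
Qed.

Lemma good_next s n : good s.+2 n -> good s.+1 (bsize n).
Proof.
case=> st h; split; first exact: ltnW.
set W := weight s.+1; pose Q := W * m%:R * L ^+ 4.
have W0 : 0 < W by rewrite mulr_gt0 ?exprn_gt0 //; apply: lt_le_trans m1.
have m0 : 0 < m%:R :> R by apply: lt_le_trans m1.
have Q0 : 0 < Q by rewrite !mulr_gt0 ?exprn_gt0.
have WQ : weight s.+2 = Q ^+ 2.
  rewrite /Q /W /weight !exprMn -!exprM.
  rewrite [LHS](_ : _ = m%:R ^+ ((2 ^ s.+2 - 2) * 2 + 2) * L ^+ ((9 * 2 ^ s.+1 - 8) * 2 + 8)).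
    by rewrite !exprD; ring.
  by have [-> ->] := exponents_double s.
set th := 4 ^+ s.+2 / L ^+ 2 in h.
have th0 : 0 <= th by apply: slack_ge0.
have th1 : th <= 1 by apply: slack_le1.
have th4 : 4 ^+ s.+1 / L ^+ 2 = th / 4.
  by rewrite /th [4 ^+ s.+2]exprS; field; rewrite gt_eqF.
rewrite th4.
have thL : 16 <= th * L ^+ 2.
  rewrite /th divfK ?gt_eqF ?exprn_gt0 // !exprS mulrA.
  have : 1 <= 4 ^+ s :> R by apply: exprn_ege1; rewrite ler1n.
  lra.
have thW : 16 <= th * W.
  apply: le_trans thL _; rewrite ler_wpM2l //.
  apply: le_trans (weight_ge s); rewrite -[leLHS]mul1r; apply: ler_pM => //.
  - by rewrite exprn_ge0 ?ltW.
  - exact: exprn_ege1.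
  by apply: ler_weXn2l.
(* For [0 <= th <= 1], [(1 + 3/8 th)^2 <= 1 + th]. *)
have sq : (1 + 3 / 8 * th) * Q <= Num.sqrt n%:R.
  rewrite -[leLHS]ger0_norm; last by rewrite mulr_ge0 ?(ltW Q0) //; lra.
  rewrite -sqrtr_sqr ler_sqrt ?ler0n // exprMn -WQ.
  apply: le_trans h; rewrite ler_wpM2r //; last by nra.
  by rewrite WQ sqr_ge0.
have xl : (1 + 3 / 8 * th) * W <= 2 * x n.
  have e : nblocks%:R * (2 * x n) * L ^+ 2 <= m%:R * L ^+ 2 * (2 * x n) * L ^+ 2.
    rewrite ler_wpM2r ?sqr_ge0 // ler_wpM2r ?nblocks_le //.
    by rewrite mulr_ge0.
  rewrite xE in e; have := le_trans sq e.
  have -> : (1 + 3 / 8 * th) * Q = m%:R * L ^+ 2 * L ^+ 2 * ((1 + 3 / 8 * th) * W).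
    by rewrite /Q; ring.
  have -> : m%:R * L ^+ 2 * (2 * x n) * L ^+ 2 = m%:R * L ^+ 2 * L ^+ 2 * (2 * x n).
    by ring.
  by rewrite ler_pM2l // !mulr_gt0 ?exprn_gt0.
(* Rounding loses less than 2, at most [th * W / 8] by [thW], which leaves the slack [th / 4]. *)
have := truncnS_gt (x n); rewrite bsizeE -natr1.
by lra.
Qed.

End Numerics.

(** * The lower bound *)

Lemma card_message m : (0 < #|{: m.-bseq bool}|)%N /\
  (#|{: m.-bseq bool}| <= 2 ^ m.+1)%N.
Proof.
rewrite card_bseq card_bool; split; first by rewrite big_ord_recl.
elim: m => [|m IH]; first by rewrite big_ord_recl big_ord0.
by rewrite big_ord_recr /= (expnS 2 m.+1) mul2n -addnn leq_add2r.
Qed.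

Lemma exponent_split t : (0 < t)%N -> (9 * 2 ^ t - 2 = 9 * 2 ^ t - 8 + 6)%N.
Proof. case: t => // t _; have : (0 < 2 ^ t)%N by rewrite expn_gt0. rewrite expnS; lia. Qed.

Section LowerBound.
Variables (R : realType) (n m t : nat) (L : R).
Hypothesis LE : log2 (n%:R : R) = L.
Hypothesis L16 : 16 <= L.
Hypothesis Lm : L <= m%:R.
Hypothesis tL : (2 ^ t)%:R <= L.
Hypothesis n0 : (0 < n)%N.
Hypothesis on : ~~ odd n.
Hypothesis large : m%:R ^+ (2 ^ t.+1 - 2) * L ^+ (9 * 2 ^ t - 2) <= n%:R.

Let L0 : 0 < L. Proof. by apply: lt_le_trans L16. Qed.
Let B : finType := m.-bseq bool.

(** Beyond [weight] the hypothesis [large] has six spare powers of [L], and the slack only asks for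
    a factor 2. *)
Let good_top : (0 < t)%N -> good m t L t n.
Proof.
move=> t0; split => //; apply: le_trans large.
have W0 : 0 <= weight m L t.
  by rewrite mulr_ge0 ?exprn_ge0 ?ler0n ?(ltW L0).
apply: le_trans (_ : 2 * weight m L t <= _).
  rewrite ler_wpM2r //; have := slack_le1 L16 tL (leqnn t); lra.
rewrite (exponent_split t0) exprD mulrA -/(weight m L t) mulrC.
rewrite ler_wpM2l //; apply: le_trans (_ : L <= _); first by have := L16; lra.
by rewrite -[leLHS]expr1; apply: ler_weXn2l => //; have := L16; lra.
Qed.

Let k_pos : (0 < nblocks R m n)%N := nblocks_pos LE L16 Lm.

(** Here [tau] is [1 / L]. With [ln #|B| <= 2 m] and at least [m L^2 / 2] blocks, the entropy term
    is at most [4 t / L]; the other two give [2 / L] and [1024 / L]. *)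
Lemma round_loss_le : round_loss m n L L^-1 B t <= (4 * t%:R + 1026) / L.
Proof.
have m1 : 1 <= m%:R :> R by have := L16; have := Lm; lra.
have m0 : 0 < m%:R :> R by lra.
have kE : m%:R * L ^+ 2 / 2 <= (nblocks R m n)%:R := nblocks_ge LE L16 Lm.
have k0 : 0 < (nblocks R m n)%:R :> R by rewrite ltr0n.
have [B0 B2] := card_message m.
have lnB : ln (#|B|%:R : R) <= 2 * m%:R.
  apply: (@le_trans _ _ (ln ((2 ^ m.+1)%:R))).
    by rewrite ler_ln ?posrE ?ltr0n ?ler_nat // expn_gt0.
  rewrite natrX lnXn // -[_ *+ _]mulr_natl -natr1.
  have l2 : ln (2 : R) <= 1.
    by apply: (@le_ln1Dx R 1); lra.
  apply: (@le_trans _ _ ((m%:R + 1) * 1)); last by lra.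
  by rewrite ler_wpM2l //; lra.
rewrite /round_loss.
have -> : (4 * t%:R + 1026) / L = 4 * t%:R / L + 2 * L^-1 + 1024 / L by ring.
rewrite !lerD2r ler_pdivrMr; last by rewrite mulr_gt0 ?invr_gt0.
apply: (@le_trans _ _ (t%:R * (2 * m%:R))); first by rewrite ler_wpM2l ?ler0n.
have -> : 4 * t%:R / L * ((nblocks R m n)%:R / L) =
    t%:R * (4 * (nblocks R m n)%:R / L ^+ 2) by field; rewrite gt_eqF.
rewrite ler_wpM2l ?ler0n // ler_pdivlMr ?exprn_gt0 //; lra.
Qed.

Let n_even : n = (n./2).*2.
Proof. by rewrite -[LHS]odd_double_half (negPf on). Qed.

(** The [t] rounds lose [t (4 t + 1026) / L] and imbalance loses [8 t / L] on average; [t <= t^2]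
    merges these into one term. *)
Lemma error_ge (p : protocol n m) : 2^-1 - 1038 * t%:R ^+ 2 / L <= error R n p t.
Proof.
have cl := core_le LE L16 Lm; have no := node_ok LE L16 Lm.
pose imb (P : {set 'I_n}) : R := imbalance R m n t n (set_owner P).
pose rl : R := round_loss m n L L^-1 B t.
have step (P : {set 'I_n}) : 2^-1 - t%:R * rl - imb P <=
    \sum_(A : {set 'I_(n.*2)}) D R m n A * (~~ correct R n p t P A)%:R.
  apply: (protocol_error_ge cl) => Q q hQ.
  have -> : imb P = imbalance R m n t n Q.
    by case: hQ => ->; rewrite ?(imbalanceC _ _ _ _ _ (set_owner P)).
  rewrite /rl; have := good_top; have := tL; clear p.
  case: (t) q => [|s] q sL gt.
    by rewrite mul0r !subr0; apply: game_error_silent.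
  have [B0 _] := card_message m.
  apply: (@game_error_ge R m n (good m s.+1 L) L L^-1 B s.+1 cl no k_pos L0 _ _
    _ _ B0 s n n Q B 1) => //.
  - by rewrite invr_gt0.
  - by rewrite lef_pV2 ?posrE //; have := L16; lra.
  - by move=> s' n'; apply: good_node.
  - by move=> s' n'; apply: (good_next LE L16 Lm sL).
  - exact: gt.
have -> : error R n p t = half_mean (fun P =>
    \sum_(A : {set 'I_(n.*2)}) D R m n A * (~~ correct R n p t P A)%:R).
  rewrite /error /half_mean exchange_big; apply: eq_bigr => P _ /=.
  by rewrite mulr_sumr; apply: eq_bigr => A _; rewrite -mulrA mulrCA.
apply: (@le_trans _ _ (half_mean (fun P => 2^-1 - t%:R * rl - imb P))); last first.
  by apply: ler_sum => P _; rewrite ler_wpM2l // invr_ge0 ler0n.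
have -> : half_mean (fun P => 2^-1 - t%:R * rl - imb P) =
    2^-1 - t%:R * rl - half_mean imb.
  rewrite -[X in X - half_mean imb](half_mean_const n_even) /half_mean -sumrB.
  by apply: eq_bigr => P _; rewrite mulrBr.
have hI : half_mean imb <= t%:R * (8 / L).
  apply: (@half_mean_imbalance R m n n n_even cl k_pos (good m t L) L L0 _ _ t n id) => //.
  - by move=> s' n'; apply: (good_next LE L16 Lm tL).
  - by move=> s' n'; apply: (good_large L16 Lm).
  by case: (posnP t) => [->|/good_top]; [left | right].
have hR : t%:R * rl <= t%:R * ((4 * t%:R + 1026) / L).
  by rewrite ler_wpM2l ?ler0n // round_loss_le.
have tt : t%:R <= t%:R ^+ 2 :> R.
  rewrite -natrX ler_nat -mulnn; case: (posnP t) => [-> //|tp].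
  exact: leq_pmulr.
have : (4 * t%:R ^+ 2 + 1034 * t%:R) / L <= 1038 * t%:R ^+ 2 / L.
  by rewrite ler_wpM2r ?invr_ge0 ?(ltW L0) //; lra.
have -> : (4 * t%:R ^+ 2 + 1034 * t%:R) / L = t%:R * ((4 * t%:R + 1026) / L) +
  t%:R * (8 / L) by ring.
lra.
Qed.

End LowerBound.

Lemma exp2_le_log (R : realType) (n m t : nat) (L : R) :
  log2 (n%:R : R) = L -> 2 <= L -> L <= m%:R -> (0 < n)%N ->
  m%:R ^+ (2 ^ t.+1 - 2) * L ^+ (9 * 2 ^ t - 2) <= n%:R -> (2 ^ t)%:R <= L.
Proof.
move=> LE L2 Lm n0 h.
have ln2 : 0 < ln (2 : R) by rewrite ln_gt0 // ltr1n.
have L0 : 0 < L by lra.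
have m1 : 1 <= m%:R :> R by lra.
have e : (2 ^ t <= 9 * 2 ^ t - 2)%N.
  have : (0 < 2 ^ t)%N by rewrite expn_gt0.
  move: (2 ^ t)%N => a; lia.
have h1 : 2 ^+ (2 ^ t) <= n%:R :> R.
  apply: le_trans h; rewrite -[leLHS]mul1r; apply: ler_pM => //.
  - exact: exprn_ge0.
  - exact: exprn_ege1.
  apply: (@le_trans _ _ (L ^+ (2 ^ t))); first by apply: lerXn2r; rewrite ?nnegrE //; lra.
  by apply: ler_weXn2l => //; lra.
have := h1; rewrite -ler_ln ?posrE ?exprn_gt0 ?ltr0n // lnXn // -[_ *+ _]mulr_natl.
by rewrite -LE /log2 /logb ler_pdivlMr.
Qed.

(** Replacing [L] by [m] gives [n <= m ^ (11 * 2^t - 4)], and 11 is rounded up to 16, whose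
    logarithm is the constant 4. *)
Lemma loglog_le (R : realType) (n m t : nat) (L : R) :
  log2 (n%:R : R) = L -> 2 <= L -> L <= m%:R -> (1 < n)%N ->
  n%:R / L ^+ (9 * 2 ^ t - 2) < m%:R ^+ (2 ^ t.+1 - 2) ->
  log2 (logb m%:R (n%:R : R)) - 4 <= t%:R.
Proof.
move=> LE L2 Lm n1 h.
have ln2 : 0 < ln (2 : R) by rewrite ln_gt0 // ltr1n.
have L0 : 0 < L by lra.
have m1 : 1 < m%:R :> R by lra.
have lnm : 0 < ln (m%:R : R) by rewrite ln_gt0.
have lnn : 0 < ln (n%:R : R) by rewrite ln_gt0 // ltr1n.
have h1 : n%:R <= m%:R ^+ (2 ^ (t + 4)) :> R.
  move: h; rewrite ltr_pdivrMr ?exprn_gt0 // => /ltW h; apply: le_trans h _.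
  apply: (@le_trans _ _ (m%:R ^+ (2 ^ t.+1 - 2) * m%:R ^+ (9 * 2 ^ t - 2))).
    rewrite ler_wpM2l ?exprn_ge0 ?ler0n //.
    by apply: lerXn2r; rewrite ?nnegrE ?ler0n ?(ltW L0).
  rewrite -exprD; apply: ler_weXn2l; first exact: ltW.
  rewrite expnS expnD; move: (2 ^ t)%N => a; lia.
have h2 : logb m%:R (n%:R : R) <= 2 ^+ (t + 4).
  rewrite /logb ler_pdivrMr // -natrX mulr_natl -lnXn ?(lt_trans _ m1) //.
  by rewrite ler_ln ?posrE ?ltr0n ?exprn_gt0 ?(lt_trans _ m1) // (ltn_trans _ n1).
have l0 : 0 < logb m%:R (n%:R : R) by rewrite /logb divr_gt0.
rewrite lerBlDr /log2 {1}/logb ler_pdivrMr //.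
have h3 : ln (logb m%:R (n%:R : R)) <= (t + 4)%:R * ln 2.
  by rewrite mulr_natl -lnXn // ler_ln ?posrE ?exprn_gt0.
by rewrite natrD in h3.
Qed.

Theorem theorem2 (R : realType) :
  exists c : R, forall eps : R, eps < 2^-1 ->
  exists n1 : nat, forall n m t : nat,
    (n1 <= n)%N -> ~~ odd n -> log2 (n%:R : R) <= m%:R ->
  forall p : protocol n m,
    error R n p t <= eps ->
    n%:R / log2 (n%:R : R) ^+ (9 * 2 ^ t - 2) < m%:R ^+ (2 ^ t.+1 - 2) /\
    log2 (logb m%:R (n%:R : R)) - c <= t%:R.
Proof.
exists 4 => eps eps2.
pose e := 2^-1 - eps; have e0 : 0 < e by rewrite subr_gt0.
(* This [K] makes [1038 * t ^+ 2 / L] small for [t <= 8 * 1038 / e]; for larger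
   [t] the bound [t ^+ 3 <= 8 * L] suffices. *)
pose K : R := 16 + 8 ^+ 2 * 1038 ^+ 3 / e ^+ 3.
have K16 : 16 <= K by rewrite lerDl divr_ge0 ?mulr_ge0 ?exprn_ge0 // ltW.
(* This makes [log2 n] larger than [K]. *)
exists (2 ^ (Num.truncn K).+1)%N => n m t nn1 on Lm p err.
have n0 : (0 < n)%N by apply: leq_trans nn1; rewrite expn_gt0.
have n1 : (1 < n)%N by case: (n) n0 on => [|[|]].
have ln2 : 0 < ln (2 : R) by rewrite ln_gt0 // ltr1n.
pose L : R := log2 n%:R.
have LE : log2 (n%:R : R) = L by [].
have LK : K < L.
  apply: (@lt_le_trans _ _ (Num.truncn K).+1%:R); first exact: truncnS_gt.
  rewrite /L /log2 /logb ler_pdivlMr // mulr_natl -lnXn //.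
  by rewrite ler_ln ?posrE ?exprn_gt0 ?ltr0n // -natrX ler_nat.
clearbody L; rewrite LE in Lm *.
have L16 : 16 <= L by apply: le_trans K16 (ltW LK).
have L2 : 2 <= L by lra.
have L0 : 0 < L by lra.
suff main : n%:R / L ^+ (9 * 2 ^ t - 2) < m%:R ^+ (2 ^ t.+1 - 2).
  by split => //; apply: (loglog_le LE).
(* If the inequality failed, [n] would be large enough for all [t] rounds, and [error_ge] would push
   the error above [eps]. *)
rewrite ltNge; apply/negP; rewrite ler_pdivlMr ?exprn_gt0 // => large.
have tL := exp2_le_log LE L2 Lm n0 large.
have := le_trans (error_ge LE L16 Lm tL n0 on large p) err.
have t3 : t%:R ^+ 3 <= 8 * L.
  apply: (@le_trans _ _ (8 * (2 ^ t)%:R)); last by rewrite ler_wpM2l.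
  by rewrite -natrX -natrM ler_nat cube_le_exp.
suff : 1038 * t%:R ^+ 2 / L < e by rewrite /e; lra.
rewrite ltr_pdivrMr //.
have [te|te] := lerP (t%:R * e) (8 * 1038).
  have : (t%:R * e) ^+ 2 <= (8 * 1038) ^+ 2.
    by apply: lerXn2r; rewrite ?nnegrE ?mulr_ge0 ?ler0n ?(ltW e0).
  have : 8 ^+ 2 * 1038 ^+ 3 < L * e ^+ 3.
    rewrite -ltr_pdivrMr ?exprn_gt0 //; apply: lt_trans LK; rewrite /K; lra.
  move=> h1 h2.
  rewrite -(ltr_pM2r (exprn_gt0 2 e0)).
  apply: le_lt_trans (_ : 1038 * (8 * 1038) ^+ 2 < _); last lra.
  by rewrite -mulrA -exprMn ler_wpM2l.
have t0 : 0 <= t%:R ^+ 2 :> R by apply: sqr_ge0.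
have tpos : 0 < t%:R ^+ 2 :> R.
  rewrite exprn_gt0 // lt0r ler0n andbT; apply/eqP => t_eq.
  by rewrite t_eq mul0r in te; lra.
have : t%:R ^+ 2 * (8 * 1038) < t%:R ^+ 2 * (t%:R * e) by rewrite ltr_pM2l.
have : t%:R ^+ 3 * e <= 8 * L * e by rewrite ler_wpM2r // ltW.
have -> : t%:R ^+ 3 * e = t%:R ^+ 2 * (t%:R * e) by ring.
lra.
Qed.
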